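(* Let $T>0$, $I=[0,T]$, let $R:[0,T]^2\to\mathbb{R}$ be a symmetric, continuous function and let $\sigma^2(s,t)=R(s,s)+R(t,t)-2R(s,t)$. Assume that the (Schwartz) distributional mixed derivative $\mu:=\frac{\partial^2R}{\partial_t\partial_s}=-\frac12\frac{\partial^2\sigma^2}{\partial_t\partial_s}$ is a (signed) Radon measure on $(0,T)^2\setminus D$ with decomposition $\mu=\mu_+-\mu_-$. Part A. Assume that: (A.i) $\mu_-$ has finite mass and a continuous distribution function; (A.ii) there exists $h>0$ such that $\sigma^2(s,t)\ge0$ whenever $|t-s|\le h$. Then $$V_1(R;[s,t]\times[u,v])\le R\binom{s,t}{u,v}+2\mu_-([s,t]\times[u,v])\qquad\text{for all }[s,t]\times[u,v]\subseteq[0,T]^2 .$$ Part B. Let $\rho\ge1$ and let $\omega:\{(s,t): s\le t\in I\}\to[0,\infty)$ be a super-additive function. Assume that: (B.i) $\mu_+$ has finite mass and a continuous distribution function; (B.ii) there exists $h>0$ such that $$2R\binom{s,t}{u,v}=\sigma^2(s,v)-\sigma^2(s,u)+\sigma^2(u,t)-\sigma^2(v,t)\ge0\qquad\text{for all }[u,v]\subseteq[s,t]\subseteq I\text{ with }|t-s|\le h;$$ (B.iii) $|\sigma^2(s,t)|\le\omega(s,t)^{1/\rho}$ for all $s<t$ in $I$. Then for all $[s,t]^2\subset D_h$ we have $$V_{1,\rho}(R;[s,t]^2)\le C\big(\omega^{1/\rho}(s,t)+\mu_+([s,t]^2)\big)$$ for some constant $C=C(\rho)$. If, in addition, $R$ satisfies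 the Cauchy--Schwarz inequality $\big|R\binom{s,t}{u,v}\big|\le\big|R\binom{s,t}{s,t}\big|^{1/2}\big|R\binom{u,v}{u,v}\big|^{1/2}$ for all $[s,t]\times[u,v]\subseteq I^2$, then, more generally, there is a constant $C=C(\rho,h,T)$ such that $$V_{1,\rho}(R;[s,t]\times[u,v])\le C\big(\omega^{1/(2\rho)}(s,t)\,\omega^{1/(2\rho)}(u,v)+\mu_+([s,t]\times[u,v])\big)$$ for all rectangles $[s,t]\times[u,v]\subset[0,T]^2$.
   Context: $D=\{(s,s):s\in I\}$ is the diagonal of $I^2$ and $D_h=\{(s,t)\in I^2:|s-t|\le h\}$. Rectangular increments: $R\binom{s,t}{u,v}=R(s,u)-R(s,v)-R(t,u)+R(t,v)$. A signed Radon measure $\mu$ on $(0,T)^2\setminus D$ is a locally finite signed Borel measure with decomposition $\mu=\mu_+-\mu_-$, where $\mu_\pm$ are locally finite nonnegative Borel measures, one of which has finite mass. That $\mu$ is the distributional mixed derivative means $\int R(s,t)\,\partial_{s,t}\varphi(s,t)\,ds\,dt=\int\varphi\,d\mu$ for all $\varphi\in C_c^\infty((0,T)^2\setminus D)$. A finite measure $\nu$ on $(0,T)^2\setminus D$ is extended to $[0,T]^2$ by $\nu(A):=\nu(A\cap((0,T)^2\setminus D))$; its distribution function is $(s,t)\mapsto\nu([0,s]\times[0,t])$. Super-additive: $\omega(s,r)+\omega(r,t)\le\omega(s,t)$ for all $s\le r\le t$. $\mathcal{D}([s,t])$ is the set of all (finite) dissections of $[s,t]$. For $\gamma,\rho\ge1$,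 $$V_{\gamma,\rho}(R;[s,t]\times[u,v])=\sup_{(t_i)\in\mathcal{D}([s,t]),\,(t'_j)\in\mathcal{D}([u,v])}\Big(\sum_{t'_j}\Big(\sum_{t_i}\Big|R\tbinom{t_i,t_{i+1}}{t'_j,t'_{j+1}}\Big|^{\gamma}\Big)^{\rho/\gamma}\Big)^{1/\rho},$$ and $V_\rho=V_{\rho,\rho}$; in particular $V_1=V_{1,1}$. *)

(* Defs.v *)
From HB Require Import structures.
From mathcomp Require Import all_boot all_order all_algebra.
From mathcomp Require Import all_classical all_reals all_analysis.
From mathcomp Require Import ring.

Set Implicit Arguments.
Unset Strict Implicit.
Unset Printing Implicit Defensive.

Import Order.TTheory GRing.Theory Num.Theory numFieldNormedType.Exports.

Local Open Scope classical_set_scope.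
Local Open Scope ring_scope.

(* The plane carries the product of the Borel sigma-algebras of the line. *)
Notation plane_measure K :=
  {measure set (measurableTypeR K * measurableTypeR K) -> \bar K}.

(* A function on [0, T]^2 is represented by a total
    function R : K -> K -> K whose values outside [0, T]^2 are never used. *)

Definition square (K : realType) (T : K) : set (K * K) :=
  `[0, T]%classic `*` `[0, T]%classic.

Definition rect_incr (K : realType) (R : K -> K -> K) (s t u v : K) : K :=
  R s u - R s v - R t u + R t v.

Definition sigma2 (K : realType) (R : K -> K -> K) (s t : K) : K :=
  R s s + R t t - 2 * R s t.

Definition symmetric_on (K : realType) (T : K) (R : K -> K -> K) : Prop :=
  forall s t, s \in `[0, T] -> t \in `[0, T] -> R s t = R t s.

Lemma rect_incr_sigma2 (K : realType) (T : K) (R : K -> K -> K) (s t u v : K) :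
  symmetric_on T R -> t \in `[0, T] -> u \in `[0, T] -> v \in `[0, T] ->
  2 * rect_incr R s t u v =
  sigma2 R s v - sigma2 R s u + sigma2 R u t - sigma2 R v t.
Proof.
move=> symR tT uT vT; rewrite /rect_incr /sigma2 (symR u t) // (symR v t) //.
ring.
Qed.

Definition offdiag (K : realType) (T : K) : set (K * K) :=
  [set z | [/\ 0 < z.1 < T, 0 < z.2 < T & z.1 != z.2]].

Fixpoint is_Cn (K : realType) (n : nat) (f : K * K -> K) : Prop :=
  continuous f /\
  if n is m.+1 then
    [/\ forall z, derivable f z (1, 0), forall z, derivable f z (0, 1),
        is_Cn m (fun z => 'D_(1, 0) f z) & is_Cn m (fun z => 'D_(0, 1) f z)]
  else True.

Definition smooth (K : realType) (f : K * K -> K) : Prop :=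
  forall n, is_Cn n f.

(* Elements of C_c^oo(U), extended by zero to the whole plane. *)
Definition test_function (K : realType) (U : set (K * K)) (f : K * K -> K)
    : Prop :=
  [/\ smooth f, compact (closure [set z | f z != 0]) &
      closure [set z | f z != 0] `<=` U].

(* A Borel measure on offdiag T is given by
    a Borel measure nu of the plane, of which only the values on subsets of
    offdiag T are used. *)

Definition ext_meas (K : realType) (T : K) (nu : plane_measure K)
    (A : set (K * K)) : \bar K :=
  nu (A `&` offdiag T).

Definition rect (K : realType) (s t u v : K) : set (K * K) :=
  `[s, t]%classic `*` `[u, v]%classic.

Definition locally_finite (K : realType) (T : K) (nu : plane_measure K)
    : Prop :=
  forall z, offdiag T z ->
  exists V : set (K * K),
    [/\ nbhs z V, measurable (V : set (measurableTypeR K * measurableTypeR K))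
      & (ext_meas T nu V < +oo)%E].

Definition finite_mass (K : realType) (T : K) (nu : plane_measure K) : Prop :=
  (ext_meas T nu setT < +oo)%E.

(* Only meaningful when nu has finite mass. *)
Definition distribution_fun (K : realType) (T : K) (nu : plane_measure K)
    (z : K * K) : K :=
  fine (ext_meas T nu (rect 0 z.1 0 z.2)).

Definition continuous_distribution (K : realType) (T : K)
    (nu : plane_measure K) : Prop :=
  {within square T, continuous (distribution_fun T nu)}.

(* The pair (mup, mum) represents the signed Radon measure mup - mum, which is
   well defined (possibly infinite) on Borel sets because one of the two
   measures has finite mass. *)
Definition signed_radon (K : realType) (T : K) (mup mum : plane_measure K)
    : Prop :=
  [/\ locally_finite T mup, locally_finite T mum &
      finite_mass T mup \/ finite_mass T mum].

Definition is_mixed_derivative (K : realType) (T : K) (R : K -> K -> K)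
    (mup mum : plane_measure K) : Prop :=
  forall phi : K * K -> K, test_function (offdiag T) phi ->
  (\int[(@lebesgue_measure K \x @lebesgue_measure K)%E]_(z in offdiag T)
     (R z.1 z.2 * 'D_(1, 0) (fun w : K * K => 'D_(0, 1) phi w) z)%:E =
   \int[mup]_(z in offdiag T) (phi z)%:E -
   \int[mum]_(z in offdiag T) (phi z)%:E)%E.

Definition standing_assumptions (K : realType) (T : K) (R : K -> K -> K)
    (mup mum : plane_measure K) : Prop :=
  [/\ symmetric_on T R,
      {within square T, continuous (fun z : K * K => R z.1 z.2)},
      signed_radon T mup mum &
      is_mixed_derivative T R mup mum].

(* With itv_partition s t p, the dissection is s :: p; the
    only dissection of the degenerate interval [s, s] is the point s itself,
    for which the sum is empty. *)

Definition variation_sum (K : realType) (gamma rho : K) (R : K -> K -> K)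
    (s u : K) (p q : seq K) : K :=
  (\sum_(0 <= j < size q)
     (\sum_(0 <= i < size p)
        `|rect_incr R (nth s (s :: p) i) (nth s (s :: p) i.+1)
                      (nth u (u :: q) j) (nth u (u :: q) j.+1)| `^ gamma)
       `^ (rho / gamma)) `^ rho^-1.

Definition mixed_variation (K : realType) (gamma rho : K) (R : K -> K -> K)
    (s t u v : K) : \bar K :=
  ereal_sup [set x | exists p q,
    [/\ itv_partition s t p, itv_partition u v q &
        x = (variation_sum gamma rho R s u p q)%:E]].

Definition nonneg_on (K : realType) (T : K) (omega : K -> K -> K) : Prop :=
  forall s t, 0 <= s -> s <= t -> t <= T -> 0 <= omega s t.

Definition super_additive (K : realType) (T : K) (omega : K -> K -> K)
    : Prop :=
  forall s r t, 0 <= s -> s <= r -> r <= t -> t <= T ->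
  omega s r + omega r t <= omega s t.

Definition nested_incr_ge0 (K : realType) (T h : K) (R : K -> K -> K) : Prop :=
  forall s t u v, 0 <= s -> s <= u -> u <= v -> v <= t -> t <= T ->
  `|t - s| <= h -> 0 <= 2 * rect_incr R s t u v.

Definition cauchy_schwarz (K : realType) (T : K) (R : K -> K -> K) : Prop :=
  forall s t u v, 0 <= s -> s <= t -> t <= T -> 0 <= u -> u <= v -> v <= T ->
  `|rect_incr R s t u v| <=
  Num.sqrt `|rect_incr R s t s t| * Num.sqrt `|rect_incr R u v u v|.

Definition near_diag (K : realType) (T h : K) : set (K * K) :=
  [set z | square T z /\ `|z.1 - z.2| <= h].

Definition partB_hypotheses (K : realType) (T h rho : K) (R : K -> K -> K)
    (mup : plane_measure K) (omega : K -> K -> K) : Prop :=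
  [/\ nonneg_on T omega /\ super_additive T omega,
      finite_mass T mup /\ continuous_distribution T mup,
      nested_incr_ge0 T h R &
      forall s t, 0 <= s -> s < t -> t <= T ->
        `|sigma2 R s t| <= omega s t `^ rho^-1].

(* Main.v *)
(** Only one half of the identity between R and its mixed derivative is needed.
    Testing it against a smooth product bump supported strictly inside a
    rectangle A whose interior misses the diagonal, and whose mixed derivative
    is a signed sum of four approximate point masses at the corners of A, gives
    - mu_-(A) <= R(A) when mu_- is finite and R(A) <= mu_+(A) when mu_+ is
    finite.  By continuity of R, A may touch the diagonal or the boundary of
    the square.

    Part A: R + mu_- has nonnegative increments off the diagonal and, since
    R(s,t;s,t) = sigma^2(s,t), on small diagonal squares; by additivity it has
    nonnegative increments everywhere.  Hence |R(A)| <= R(A) + 2 mu_-(A), whose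
    right-hand side telescopes along dissections.

    Part B: off the diagonal |R(A)| <= 2 mu_+(A) - R(A).  Over a column [p, q]
    of a square near the diagonal, the row sum is then at most
    2 sigma^2(p, q) + 2 mu_+ - R(s,t;p,q), and the last increment is nonnegative
    by nestedness.  General rectangles are cut into boundedly many pieces off
    the diagonal, where Cauchy-Schwarz bounds R, and small diagonal squares. *)
Require Import Defs.
From HB Require Import structures.
From mathcomp Require Import all_boot all_order all_algebra.
From mathcomp Require Import all_classical all_reals all_analysis.
From mathcomp Require Import measurable_realfun.
From mathcomp Require Import ring lra.

Set Implicit Arguments.
Unset Strict Implicit.
Unset Printing Implicit Defensive.

Import Order.TTheory GRing.Theory Num.Theory numFieldNormedType.Exports.

Local Open Scope classical_set_scope.
Local Open Scope ring_scope.

(** * Smooth step functions *)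

Section smooth_step.
Variable K : realType.
Implicit Types (p : {poly K}) (f g : K -> K) (x : K) (n : nat).

(** One-variable counterpart of [is_Cn]. Continuity of the last derivative is not demanded; it
    follows by asking for one order more. *)
Fixpoint nderivable n f : Prop :=
  if n is m.+1
  then (forall x, derivable f x 1) /\ nderivable m (derive1 f) else True.

Lemma nderivableW n f : nderivable n.+1 f -> nderivable n f.
Proof. by elim: n f => [//|n IH] f [df /IH ?]; split. Qed.

Lemma nderivable_cont n f : nderivable n.+1 f -> continuous f.
Proof. by case=> df _ x; apply/differentiable_continuous/derivable1_diffP. Qed.

Lemma nderivableD n f g :
  nderivable n f -> nderivable n g -> nderivable n (f \+ g).
Proof.
elim: n f g => [//|n IH] f g [df nf] [dg ng].
split=> [x|]; first exact: derivableD.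
suff -> : derive1 (f \+ g) = (derive1 f) \+ (derive1 g) by exact: IH.
by apply/funext => x /=; rewrite !derive1E deriveD.
Qed.

Lemma nderivableN n f : nderivable n f -> nderivable n (fun x => - f x).
Proof.
elim: n f => [//|n IH] f [df nf].
split=> [x|]; first exact: derivableN.
suff -> : derive1 (fun x => - f x) = (fun x => - derive1 f x) by exact: IH.
by apply/funext => x /=; rewrite !derive1E deriveN.
Qed.

Lemma nderivableM n f g :
  nderivable n f -> nderivable n g -> nderivable n (f \* g).
Proof.
elim: n f g => [//|n IH] f g [df nf] [dg ng].
split=> [x|]; first exact: derivableM.
have -> : derive1 (f \* g) = (f \* (derive1 g)) \+ (g \* (derive1 f)).
  by apply/funext => x /=; rewrite !derive1E deriveM.
by apply: nderivableD; apply: IH => //; apply: nderivableW; split.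
Qed.

(** The derivative of [1 / f] is [- (1 / f) * (1 / f) * f'], so the induction hypothesis for [1 / f]
    itself, one order lower, suffices. *)
Lemma nderivableV n f :
  (forall x, f x != 0) -> nderivable n f -> nderivable n (fun x => (f x)^-1).
Proof.
move=> f0; elim: n => [//|n IH] [df nf].
split=> [x|]; first exact: derivableV.
have -> : derive1 (fun x => (f x)^-1) =
    (fun x => - ((fun y => (f y)^-1) \* (fun y => (f y)^-1) \* (derive1 f)) x).
  apply/funext => x /=; rewrite !derive1E deriveV//=.
  by rewrite -exprVn expr2 /GRing.scale/= mulNr.
have nV : nderivable n (fun x => (f x)^-1).
  by apply: IH; apply: nderivableW; split.
by apply: nderivableN; do 2?apply: nderivableM.
Qed.

(* Every derivative of [x |-> exp (- 1 / x)] extended by [0] has this form. *)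
Definition flat p x : K := if 0 < x then p.[x^-1] * expR (- x^-1) else 0.

(** [expR x] is the [n]-th power of [expR (x / n)], which dominates [x / n]. *)
Lemma exprn_le_expR n x : 0 <= x -> x ^+ n <= n%:R ^+ n * expR x.
Proof.
case: n => [|n] x0; first by rewrite !expr0 mul1r -expR0 ler_expR.
have -> : x = n.+1%:R * (x / n.+1%:R) by rewrite mulrC divfK ?pnatr_eq0.
rewrite expRM_natl exprMn ler_wpM2l ?exprn_ge0 ?ler0n//.
apply: lerXn2r; rewrite ?nnegrE ?divr_ge0 ?ler0n ?expR_ge0//.
by apply: le_trans (expR_ge1Dx _); rewrite lerDr.
Qed.

Lemma horner_le_expR p :
  exists2 C, 0 <= C & forall x, 0 <= x -> `|p.[x]| <= C * expR x.
Proof.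
exists (\sum_(i < size p) `|p`_i| * i%:R ^+ i) => [|x x0].
  by apply: sumr_ge0 => i _; rewrite mulr_ge0 ?exprn_ge0 ?ler0n.
rewrite horner_coef mulr_suml (le_trans (ler_norm_sum _ _ _))//.
apply: ler_sum => i _; rewrite normrM -mulrA ler_wpM2l// ger0_norm ?exprn_ge0//.
exact: exprn_le_expR.
Qed.

(** Bounding [p * 'X^2] instead of [p] by the exponential at [1 / x] leaves a spare factor [x ^+ 2],
    which makes [flat p] differentiable at 0 with derivative 0. *)
Lemma flat_le p : exists2 C, 0 <= C & forall x, `|flat p x| <= C * x ^+ 2.
Proof.
have [C C0 hC] := horner_le_expR (p * 'X^2).
exists C => // x; rewrite /flat; case: ltP => x0; last first.
  by rewrite normr0 mulr_ge0 ?sqr_ge0.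
have := hC x^-1; rewrite invr_ge0 (ltW x0) => /(_ isT).
rewrite hornerM hornerXn normrM normrX.
rewrite (@gtr0_norm _ x^-1) ?invr_gt0// => h.
rewrite normrM (ger0_norm (expR_ge0 _)).
rewrite expRN ler_pdivrMr ?expR_gt0//.
have -> : `|p.[x^-1]| = `|p.[x^-1]| * x^-1 ^+ 2 * x ^+ 2.
  by rewrite -mulrA -exprMn mulVf ?gt_eqF// expr1n mulr1.
by rewrite [leRHS]mulrAC ler_wpM2r ?sqr_ge0.
Qed.

(** The family is closed under derivation: for [x > 0] the chain rule gives [x ^- 2 * (p - p')]
    evaluated at [1 / x], times the same exponential. For [x < 0] the function is locally 0; at 0
    the quadratic bound decides. *)
Lemma is_derive_flat p x :
  is_derive x 1 (flat p) (flat ('X^2 * (p - p^`())) x).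
Proof.
have [x0|x0|->] := ltgtP x 0.
- rewrite {2}/flat ltNge (ltW x0)/=.
  apply: (@near_eq_is_derive _ _ _ (cst 0)).
  near=> y; rewrite /flat ltNge ifF//; apply/negbTE; rewrite negbK.
  by apply: ltW; near: y; exact: lt_nbhsl.
- rewrite {2}/flat x0.
  apply: (@near_eq_is_derive _ K K (fun y : K => p.[y^-1] * expR (- y^-1))).
    by near=> y; rewrite /flat ifT//; near: y; exact: lt_nbhsr.
  have xn0 : x != 0 by rewrite gt_eqF.
  have dV : is_derive x 1 (fun y : K => y^-1) (- x ^- 2).
    by have := is_deriveV xn0 (is_derive_id x 1); rewrite /GRing.scale/= mulr1.
  have dN : is_derive x 1 (fun y : K => - y^-1) (- - x ^- 2).
    exact: is_deriveN.
  have de := is_derive1_comp (is_derive_expR _) dN.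
  have dp := is_derive1_comp (is_derive_poly p _) dV.
  apply: (is_derive_eq (is_deriveM dp de)); rewrite /GRing.scale/=.
  rewrite !(hornerM, hornerD, hornerN, hornerX) -exprVn; ring.
- rewrite {2}/flat ltxx.
  have [C C0 hC] := flat_le p.
  suff h : (fun h => h^-1 *: (flat p (h *: 1 + 0) - flat p 0)) @ 0^' --> (0:K).
    apply: DeriveDef; last by rewrite /derive; apply/cvg_lim.
    by rewrite /derivable; apply/cvg_ex; exists 0.
  apply/cvgrPdist_le => e e0; near=> h.
  rewrite sub0r normrN addr0 /GRing.scale/= mulr1 /flat ltxx subr0 -/(flat p h).
  have h0 : h != 0 by near: h; exact: nbhs_dnbhs_neq.
  rewrite normrM normfV ler_pdivrMl ?normr_gt0//.
  apply: (le_trans (hC h)); rewrite -[h ^+ 2]ger0_norm ?sqr_ge0//.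
  rewrite normrX expr2 mulrCA ler_wpM2l//.
  (* [C] may be 0, and the next step divides by the constant. *)
  apply: (@le_trans _ _ ((C + 1) * `|h|)); first by rewrite ler_wpM2r// lerDl.
  rewrite -ler_pdivlMl ?ltr_wpDl//.
  near: h; apply: dnbhs0_le; rewrite mulr_gt0 ?invr_gt0 ?ltr_wpDl//.
Unshelve. all: by end_near. Qed.

Lemma is_derive_flat_affine p (c d : K) x :
  is_derive x 1 (fun y => flat p (c * y + d))
    (c * flat ('X^2 * (p - p^`())) (c * x + d)).
Proof.
have da : is_derive x 1 (fun y : K => c * y + d) c.
  have h := is_deriveD (is_deriveZ c (is_derive_id x 1)) (is_derive_cst d x 1).
  by apply: (is_derive_eq h); rewrite addr0 /GRing.scale/= mulr1.
have h := is_derive1_comp (is_derive_flat p _) da.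
by apply: (is_derive_eq h); rewrite mulrC.
Qed.

Lemma nderivable_flat_affine n p (c d : K) :
  nderivable n (fun y => flat p (c * y + d)).
Proof.
(* A scalar factor is carried along because each derivative brings out another [c]. *)
suff : forall e, nderivable n (fun y => e * flat p (c * y + d)).
  by move=> /(_ 1); congr nderivable; apply/funext => y; rewrite mul1r.
elim: n p => [//|n IH] p e.
have dflat x : is_derive x 1 (fun y => e * flat p (c * y + d))
    (e * c * flat ('X^2 * (p - p^`())) (c * x + d)).
  have h := is_deriveZ e (is_derive_flat_affine p c d x).
  by apply: (is_derive_eq h); rewrite /GRing.scale/= mulrA.
split=> [x|]; first by have [] := dflat x.
have -> : derive1 (fun y => e * flat p (c * y + d)) =
    (fun x => e * c * flat ('X^2 * (p - p^`())) (c * x + d)).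
  by apply/funext => x; rewrite derive1E; have [] := dflat x.
exact: IH.
Qed.

Lemma flat1_ge0 x : 0 <= flat 1 x.
Proof. by rewrite /flat; case: ifP => // _; rewrite hornerC mul1r expR_ge0. Qed.

Lemma flat1_gt0 x : 0 < x -> 0 < flat 1 x.
Proof. by move=> x0; rewrite /flat x0 hornerC mul1r expR_gt0. Qed.

Lemma flat1_eq0 x : x <= 0 -> flat 1 x = 0.
Proof. by rewrite /flat leNgt => /negbTE->. Qed.

(** The quotient [u / (u + v)], with [u] vanishing exactly up to [a] and [v] exactly from [b] on;
    since [a < b], the denominator is never 0. *)
Lemma smooth_step (a b : K) : a < b ->
  exists F : K -> K,
    [/\ forall n, nderivable n F, forall x, 0 <= F x <= 1,
        forall x, 0 <= derive1 F x, forall x, x <= a -> F x = 0 &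
        forall x, b <= x -> F x = 1].
Proof.
move=> ab.
pose u x := flat 1 (1 * x + - a); pose v x := flat 1 (- 1 * x + b).
have u0 x : 0 <= u x by exact: flat1_ge0.
have v0 x : 0 <= v x by exact: flat1_ge0.
have uv0 x : 0 < u x + v x.
  have [ax|xa] := ltP a x.
    by rewrite ltr_pwDl// flat1_gt0//; lra.
  by rewrite ltr_wpDl// flat1_gt0//; lra.
have uvn0 x : (u \+ v) x != 0 by rewrite /= gt_eqF.
exists (u \* (fun x => ((u \+ v) x)^-1)); split=> [n|x|x|x xa|x bx] /=.
- apply: nderivableM; first exact: nderivable_flat_affine.
  apply: nderivableV => //.
  by apply: nderivableD; exact: nderivable_flat_affine.
- by rewrite divr_ge0 ?(ltW (uv0 x))//= ler_pdivrMr// mul1r lerDl.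
- have du := is_derive_flat_affine 1 1 (- a) x.
  have dv : is_derive x 1 v _ := is_derive_flat_affine 1 (- 1) b x.
  have dV := is_deriveV (uvn0 x) (is_deriveD du dv).
  have dF := is_deriveM du dV.
  (* For [p = 1] the polynomial of the derivative is ['X^2], so both [u'] and [- v'] are
     nonnegative. *)
  have pos y : 0 <= flat ('X^2 * (1 - 1^`())) y.
    rewrite /flat derivC subr0 mulr1; case: ifP => // y0.
    by rewrite hornerXn mulr_ge0 ?expR_ge0 ?sqr_ge0.
  rewrite derive1E; case: dF => _ ->.
  rewrite /GRing.scale/=.
  rewrite -/(u x); set du' := flat _ (1 * x + - a).
  set dv' := flat _ (-1 * x + b).
  have -> : u x * (- (u x + v x) ^- 2 * (1 * du' + -1 * dv')) +
      (u x + v x)^-1 * (1 * du') = (u x * dv' + v x * du') / (u x + v x) ^+ 2.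
    by field; exact: uvn0.
  by rewrite divr_ge0 ?sqr_ge0// addr_ge0// mulr_ge0// pos.
- by rewrite /u flat1_eq0 ?mul0r//; lra.
- have -> : v x = 0 by rewrite /v flat1_eq0//; lra.
  rewrite addr0 divff// /u gt_eqF// flat1_gt0//; lra.
Qed.

End smooth_step.

(** * Increments of R tested against product bumps *)

Section tensor_products.
Variable K : realType.
Implicit Types (f g : K -> K) (z : K * K) (T : K) (R : K -> K -> K).

Lemma is_derive_tensor1 f g z : derivable f z.1 1 ->
  is_derive z (1, 0) (fun w : K * K => f w.1 * g w.2) (derive1 f z.1 * g z.2).
Proof.
move=> df.
have E : (fun h : K => h^-1 *: (f (h *: (1, 0) + z).1 * g (h *: (1, 0) + z).2
      - f z.1 * g z.2)) =
    (fun h => (h^-1 *: (f (h *: 1 + z.1) - f z.1)) * g z.2).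
  apply/funext => h; rewrite /= scaler0 add0r /GRing.scale/=; ring.
have cv : h^-1 *: (f (h *: 1 + z.1) - f z.1) @[h --> 0^'] --> derive1 f z.1.
  by rewrite derive1E; exact: df.
have cvg : (fun h : K => h^-1 *: (f (h *: (1, 0) + z).1 *
    g (h *: (1, 0) + z).2 - f z.1 * g z.2)) @ 0^' --> derive1 f z.1 * g z.2.
  by rewrite E; apply: cvgMl.
apply: DeriveDef; last by rewrite /derive; apply/cvg_lim.
by rewrite /derivable; apply/cvg_ex; exists (derive1 f z.1 * g z.2).
Qed.

Lemma is_derive_tensor2 f g z : derivable g z.2 1 ->
  is_derive z (0, 1) (fun w : K * K => f w.1 * g w.2) (f z.1 * derive1 g z.2).
Proof.
move=> dg.
have E : (fun h : K => h^-1 *: (f (h *: (0, 1) + z).1 * g (h *: (0, 1) + z).2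
      - f z.1 * g z.2)) =
    (fun h => f z.1 * (h^-1 *: (g (h *: 1 + z.2) - g z.2))).
  apply/funext => h; rewrite /= scaler0 add0r /GRing.scale/=; ring.
have cv : h^-1 *: (g (h *: 1 + z.2) - g z.2) @[h --> 0^'] --> derive1 g z.2.
  by rewrite derive1E; exact: dg.
have cvg : (fun h : K => h^-1 *: (f (h *: (0, 1) + z).1 *
    g (h *: (0, 1) + z).2 - f z.1 * g z.2)) @ 0^' --> f z.1 * derive1 g z.2.
  by rewrite E; apply: cvgMr.
apply: DeriveDef; last by rewrite /derive; apply/cvg_lim.
by rewrite /derivable; apply/cvg_ex; exists (f z.1 * derive1 g z.2).
Qed.

(** Both partial derivatives of a product [f x * g y] are again such products, so the induction
    closes; the extra order supplies continuity. *)
Lemma is_Cn_tensor n f g : nderivable n.+1 f -> nderivable n.+1 g ->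
  is_Cn n (fun w : K * K => f w.1 * g w.2).
Proof.
elim: n f g => [|n IH] f g nf ng; split => //=.
- move=> z; apply: cvgM; apply: continuous_comp.
  + exact: cvg_fst.
  + exact: nderivable_cont nf _.
  + exact: cvg_snd.
  + exact: nderivable_cont ng _.
- move=> z; apply: cvgM; apply: continuous_comp.
  + exact: cvg_fst.
  + exact: nderivable_cont nf _.
  + exact: cvg_snd.
  + exact: nderivable_cont ng _.
- have [df nf'] := nf; have [dg ng'] := ng.
  have d1 z := is_derive_tensor1 g (df z.1).
  have d2 z := is_derive_tensor2 f (dg z.2).
  split=> [z|z||].
  + by have [] := d1 z.
  + by have [] := d2 z.
  + rewrite (_ : (fun z => _) = fun z : K * K => derive1 f z.1 * g z.2).
      exact: (IH _ _ nf' (nderivableW ng)).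
    by apply/funext => z; have [] := d1 z.
  + rewrite (_ : (fun z => _) = fun z : K * K => f z.1 * derive1 g z.2).
      exact: (IH _ _ (nderivableW nf) ng').
    by apply/funext => z; have [] := d2 z.
Qed.

Lemma integral_tensor f g :
  continuous f -> continuous g -> (forall x, 0 <= f x) -> (forall x, 0 <= g x) ->
  (\int[(@lebesgue_measure K \x @lebesgue_measure K)%E]_z (f z.1 * g z.2)%:E =
   (\int[@lebesgue_measure K]_x (f x)%:E) *
   (\int[@lebesgue_measure K]_x (g x)%:E))%E.
Proof.
move=> cf cg f0 g0.
have mf : measurable_fun [set: measurableTypeR K] f.
  exact: continuous_measurable_fun.
have mg : measurable_fun [set: measurableTypeR K] g.
  exact: continuous_measurable_fun.
rewrite fubini_tonelli1 /=; last 2 first.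
- apply/measurable_EFinP; apply: measurable_funM.
    exact: (measurableT_comp mf measurable_fst).
  exact: (measurableT_comp mg measurable_snd).
- by move=> z; rewrite lee_fin mulr_ge0.
rewrite /fubini_F.
pose G := (\int[@lebesgue_measure K]_y (g y)%:E)%E.
transitivity (\int[@lebesgue_measure K]_x ((f x)%:E * G))%E.
  apply: eq_integral => x _ /=.
  rewrite /G -ge0_integralZl_EFin//.
  - by move=> y _; rewrite lee_fin.
  - exact/measurable_EFinP.
rewrite ge0_integralZr//.
- exact/measurable_EFinP.
- by move=> y _; rewrite lee_fin.
- by apply: integral_ge0 => y _; rewrite lee_fin.
Qed.

End tensor_products.

Section derivative_of_step.
Variable K : realType.
Implicit Types (F : K -> K) (a b : K).

Lemma derive1_step_eq0 F a b x :
  (forall x, x <= a -> F x = 0) -> (forall x, b <= x -> F x = 1) ->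
  x \notin `[a, b] -> derive1 F x = 0.
Proof.
move=> Fa Fb; rewrite in_itv/= negb_and -!ltNge derive1E => /orP[xa|bx].
- rewrite (@near_eq_derive _ K K _ (cst 0)) ?derive_cst//.
  by near=> y; apply: Fa; apply: ltW; near: y; exact: lt_nbhsl.
- rewrite (@near_eq_derive _ K K _ (cst 1)) ?derive_cst//.
  by near=> y; apply: Fb; apply: ltW; near: y; exact: lt_nbhsr.
Unshelve. all: by end_near. Qed.

(** By the fundamental theorem of calculus; for a nondecreasing step the derivative is thus a
    probability density on [[a, b]], an approximate point mass. *)
Lemma integral_derive1_step F a b : a < b -> nderivable 2 F ->
  (forall x, x <= a -> F x = 0) -> (forall x, b <= x -> F x = 1) ->
  (\int[@lebesgue_measure K]_x (derive1 F x)%:E = 1)%E.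
Proof.
move=> ab nF Fa Fb.
have cF : continuous F by exact: (@nderivable_cont _ 1).
have [dF nF'] := nF.
have cF' : continuous (derive1 F) by exact: (@nderivable_cont _ 0).
transitivity (\int[@lebesgue_measure K]_(x in `[a, b]) (derive1 F x)%:E)%E.
  rewrite [RHS]integral_mkcond; apply: eq_integral => x _.
  rewrite patchE mem_setE; case: ifPn => // xab.
  by rewrite (derive1_step_eq0 Fa Fb).
rewrite (@continuous_FTC2 _ _ F a b ab).
- by rewrite (Fa a)// (Fb b)// sube0.
- exact: continuous_subspaceT.
- split=> [x _||].
  + exact: dF.
  + exact/cvg_at_right_filter/cF.
  + exact/cvg_at_left_filter/cF.
- by [].
Qed.

End derivative_of_step.

Section integral_facts.
Variables (d : measure_display) (X : measurableType d) (K : realType).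
Variable mu : {measure set X -> \bar K}.
Local Open Scope ereal_scope.

(* Unlike [le_integral], this needs no measurability: the lower integral of a
   nonnegative function is monotone by definition. *)
Lemma le_integral_nomeas (D : set X) (f g : X -> \bar K) :
  (forall x, D x -> f x <= g x) ->
  \int[mu]_(x in D) f x <= \int[mu]_(x in D) g x.
Proof.
move=> fg.
have fgD x : (f \_ D) x <= (g \_ D) x.
  by rewrite !patchE; case: ifPn => // /set_mem; exact: fg.
rewrite /integral; apply: leeB; apply: le_ereal_sup => _ [h /= hf <-].
  exists h => //= x; apply: le_trans (hf x) _.
  by rewrite !funeposE ge_max !le_max fgD lexx orbT.
exists h => //= x; apply: le_trans (hf x) _.
by rewrite !funenegE ge_max !le_max leeN2 fgD lexx orbT.
Qed.

End integral_facts.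

Section test_rectangles.
Variable K : realType.
Implicit Types (T s t u v : K) (R : K -> K -> K).

Local Notation leb2 := (@lebesgue_measure K \x @lebesgue_measure K)%E.
Local Notation plane := (measurableTypeR K * measurableTypeR K)%type.

Lemma continuous_square_corner T R (x y d : K) :
  {within square T, continuous (fun z : K * K => R z.1 z.2)} ->
  x \in `[0, T] -> y \in `[0, T] -> 0 < d ->
  exists2 e, 0 < e & forall z : K * K, square T z ->
    `|z.1 - x| <= e -> `|z.2 - y| <= e -> `|R z.1 z.2 - R x y| <= d.
Proof.
move=> /subspace_continuousP cR xT yT d0.
have sxy : square T (x, y) by split.
have /cvgrPdist_le /(_ _ d0) := cR _ sxy.
case=> -[A B] /= [/nbhs_ballP[a/= a0 aA] /nbhs_ballP[b/= b0 bB]] AB.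
(* Half of the smaller radius, so that closed inequalities imply membership in the open balls. *)
exists (Order.min a b / 2) => [|z sz zx zy].
  by rewrite divr_gt0// lt_min a0 b0.
have mab : 0 < Order.min a b by rewrite lt_min a0 b0.
have lab : Order.min a b / 2 < Order.min a b by lra.
rewrite distrC; apply: (AB z) => //; split => /=.
- apply: aA; rewrite /ball/= distrC; apply: le_lt_trans zx _.
  by apply: (lt_le_trans lab); rewrite ge_min lexx.
- apply: bB; rewrite /ball/= distrC; apply: le_lt_trans zy _.
  by apply: (lt_le_trans lab); rewrite ge_min lexx orbT.
Qed.

(** Each of the four products of densities has mass 1. The upper and lower bounds for the tested
    integral of [R] have this shape. *)
Lemma integral_tensor4 (f1 f2 g1 g2 : K -> K) (c11 c12 c21 c22 : K) :
  [/\ continuous f1, continuous f2, continuous g1 & continuous g2] ->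
  [/\ forall x, 0 <= f1 x, forall x, 0 <= f2 x, forall x, 0 <= g1 x &
      forall x, 0 <= g2 x] ->
  [/\ \int[@lebesgue_measure K]_x (f1 x)%:E = 1,
      \int[@lebesgue_measure K]_x (f2 x)%:E = 1,
      \int[@lebesgue_measure K]_x (g1 x)%:E = 1 &
      \int[@lebesgue_measure K]_x (g2 x)%:E = 1]%E ->
  (\int[leb2]_z (c11 * (f1 z.1 * g1 z.2) + c12 * (f1 z.1 * g2 z.2) +
     c21 * (f2 z.1 * g1 z.2) + c22 * (f2 z.1 * g2 z.2))%:E =
   (c11 + c12 + c21 + c22)%:E)%E.
Proof.
move=> [cf1 cf2 cg1 cg2] [pf1 pf2 pg1 pg2] [if1 if2 ig1 ig2].
have i1 (f g : K -> K) : continuous f -> continuous g ->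
    (forall x, 0 <= f x) -> (forall x, 0 <= g x) ->
    (\int[@lebesgue_measure K]_x (f x)%:E = 1)%E ->
    (\int[@lebesgue_measure K]_x (g x)%:E = 1)%E -> forall c : K,
    leb2.-integrable setT (fun z : plane => (c * (f z.1 * g z.2))%:E) /\
    (\int[leb2]_z (c * (f z.1 * g z.2))%:E = c%:E)%E.
  move=> cf cg pf pg if' ig c.
  have I : (\int[leb2]_z (f z.1 * g z.2)%:E = 1)%E.
    by rewrite integral_tensor// if' ig mule1.
  have mfg : measurable_fun setT (fun z : plane => f z.1 * g z.2).
    apply: measurable_funM.
      exact: (measurableT_comp (continuous_measurable_fun cf) measurable_fst).
    exact: (measurableT_comp (continuous_measurable_fun cg) measurable_snd).
  have J : leb2.-integrable setT (fun z : plane => (f z.1 * g z.2)%:E).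
    apply/integrableP; split; first exact/measurable_EFinP.
    under eq_integral => z _ do rewrite gee0_abs ?lee_fin ?mulr_ge0//.
    by rewrite I ltry.
  split.
    under eq_fun do rewrite EFinM.
    exact: integrableZl.
  under eq_integral do rewrite EFinM.
  by rewrite integralZl// I mule1.
have [j11 k11] := i1 _ _ cf1 cg1 pf1 pg1 if1 ig1 c11.
have [j12 k12] := i1 _ _ cf1 cg2 pf1 pg2 if1 ig2 c12.
have [j21 k21] := i1 _ _ cf2 cg1 pf2 pg1 if2 ig1 c21.
have [j22 k22] := i1 _ _ cf2 cg2 pf2 pg2 if2 ig2 c22.
under eq_integral do rewrite !EFinD.
rewrite !integralD//; last 2 first.
- exact: integrableD.
- by apply: integrableD => //; exact: integrableD.
by rewrite k11 k12 k21 k22.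
Qed.

(** [F1] climbs on [[s + e, s + 2 * e]] and [F2] on [[t - 2 * e, t - e]]. As [4 * e <= t - s], the
    first is complete before the second starts, so [F1 - F2] is a bump whose derivative is a density
    near [s] minus a density near [t]. *)
Lemma smooth_bump (s t e : K) : 0 < e -> 4 * e <= t - s ->
  exists F1 F2 : K -> K, let f := F1 \- F2 in
  [/\ forall n, nderivable n f,
      forall x, 0 <= f x <= 1,
      forall x, f x != 0 -> s + e <= x <= t - e,
      derive1 f = (derive1 F1 \- derive1 F2) &
  [/\ forall n, nderivable n F1 /\ nderivable n F2,
      forall x, 0 <= derive1 F1 x /\ 0 <= derive1 F2 x,
      forall x, derive1 F1 x != 0 ->
        `|x - s| <= 2 * e /\ s + e <= x <= t - e,
      forall x, derive1 F2 x != 0 ->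
        `|x - t| <= 2 * e /\ s + e <= x <= t - e &
      (\int[@lebesgue_measure K]_x (derive1 F1 x)%:E = 1)%E /\
      (\int[@lebesgue_measure K]_x (derive1 F2 x)%:E = 1)%E ] ].
Proof.
move=> e0 est.
have le1 : s + e < s + 2 * e by lra.
have le2 : t - 2 * e < t - e by lra.
have [F1 [nF1 F1_01 dF1 F1a F1b]] := smooth_step le1.
have [F2 [nF2 F2_01 dF2 F2a F2b]] := smooth_step le2.
exists F1, F2 => f; split.
- by move=> n; apply: nderivableD => //; exact: nderivableN.
- move=> x; rewrite /f/=; have [xt|tx] := leP x (t - 2 * e).
    by rewrite (F2a x)// subr0.
  rewrite (F1b x); last lra.
  by have /andP[? ?] := F2_01 x; apply/andP; split; lra.
- move=> x; apply: contraNT; rewrite negb_and -!ltNge /f/= => /orP[xs|tx].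
    by rewrite (F1a x) ?(F2a x) ?subr0//; lra.
  by rewrite (F1b x) ?(F2b x) ?subrr//; lra.
- apply/funext => x /=.
  have [d1 _] := nF1 1%N; have [d2 _] := nF2 1%N.
  by rewrite !derive1E deriveB.
split=> [//|//|x|x|].
- have [|xn /eqP[]] := boolP (x \in `[s + e, s + 2 * e]); last first.
    exact: (derive1_step_eq0 F1a F1b).
  rewrite in_itv/= => /andP[x1 x2] _; split; last by apply/andP; split; lra.
  by rewrite ler_norml; apply/andP; split; lra.
- have [|xn /eqP[]] := boolP (x \in `[t - 2 * e, t - e]); last first.
    exact: (derive1_step_eq0 F2a F2b).
  rewrite in_itv/= => /andP[x1 x2] _; split; last by apply/andP; split; lra.
  by rewrite ler_norml; apply/andP; split; lra.
- split; first exact: (integral_derive1_step le1).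
  exact: (integral_derive1_step le2).
Qed.

Lemma small_margin (s t u v r1 r2 r3 r4 : K) : s < t -> u < v ->
  0 < r1 -> 0 < r2 -> 0 < r3 -> 0 < r4 ->
  exists e, [/\ 0 < e, 4 * e <= t - s /\ 4 * e <= v - u &
    [/\ 2 * e <= r1, 2 * e <= r2, 2 * e <= r3 & 2 * e <= r4]].
Proof.
move=> st uv r10 r20 r30 r40.
pose m := Order.min (Order.min (t - s) (v - u))
  (Order.min (Order.min r1 r2) (Order.min r3 r4)).
have m0 : 0 < m by rewrite /m !lt_min !subr_gt0 st uv r10 r20 r30 r40.
have := lexx m; rewrite {2}/m !le_min.
move=> /andP[/andP[m1 m2] /andP[/andP[m3 m4] /andP[m5 m6]]].
by exists (m / 4); split; [lra|split; lra|split; lra].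
Qed.

Lemma shrunk_rect_offdiag T s t u v e : 0 < e ->
  0 <= s -> t <= T -> 0 <= u -> v <= T -> t <= u \/ v <= s ->
  `[s + e, t - e]%classic `*` `[u + e, v - e]%classic `<=` offdiag T.
Proof.
move=> e0 s0 tT u0 vT off z [/=]; rewrite !in_itv/= => /andP[a1 a2] /andP[b1 b2].
split; [by apply/andP; split; lra..|].
by case: off => o; [rewrite lt_eqF//|rewrite gt_eqF//]; lra.
Qed.

(** To be read with [r] a value of [R], the [c]'s its values at the corners, the [w]'s the corner
    densities and [e] the oscillation; at the two corners of negative sign the error changes
    sides. *)
Lemma le_signed_sum4 (r w1 w2 w3 w4 c1 c2 c3 c4 e : K) :
  (c1 - e) * w1 <= r * w1 <= (c1 + e) * w1 ->
  (c2 - e) * w2 <= r * w2 <= (c2 + e) * w2 ->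
  (c3 - e) * w3 <= r * w3 <= (c3 + e) * w3 ->
  (c4 - e) * w4 <= r * w4 <= (c4 + e) * w4 ->
  (c1 - e) * w1 + - (c2 + e) * w2 + - (c3 + e) * w3 + (c4 - e) * w4 <=
    r * (w1 - w2 - w3 + w4) <=
  (c1 + e) * w1 + - (c2 - e) * w2 + - (c3 - e) * w3 + (c4 + e) * w4.
Proof.
move=> /andP[a1 b1] /andP[a2 b2] /andP[a3 b3] /andP[a4 b4].
by rewrite mulrDr !mulrBr !mulNr !lerD// lerN2.
Qed.

(** The mixed derivative of a product bump is a signed sum of four densities near the corners. On
    the support of each, [R] is within [d / 4] of its corner value, so the tested integral is within
    [d] of the increment. *)
Lemma test_rectangle T R s t u v d :
  {within square T, continuous (fun z : K * K => R z.1 z.2)} ->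
  0 <= s -> s < t -> t <= T -> 0 <= u -> u < v -> v <= T ->
  t <= u \/ v <= s -> 0 < d ->
  exists phi : K * K -> K,
    [/\ test_function (offdiag T) phi,
        forall z, 0 <= phi z,
        forall z, phi z <= \1_(`]s, t]%classic `*` `]u, v]%classic) z,
        ((rect_incr R s t u v - d)%:E <=
         \int[leb2]_(z in offdiag T) (R z.1 z.2 *
           'D_(1, 0) (fun w : K * K => 'D_(0, 1) phi w) z)%:E)%E &
        (\int[leb2]_(z in offdiag T) (R z.1 z.2 *
           'D_(1, 0) (fun w : K * K => 'D_(0, 1) phi w) z)%:E <=
         (rect_incr R s t u v + d)%:E)%E].
Proof.
move=> cR s0 st tT u0 uv vT off d0.
have d40 : 0 < d / 4 by rewrite divr_gt0.
have inT (x : K) : 0 <= x -> x <= T -> x \in `[0, T].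
  by move=> x0 xT; rewrite in_itv/= x0.
have t0 : 0 <= t by lra. have v0 : 0 <= v by lra.
have sT : s <= T by lra. have uT : u <= T by lra.
have [e11 e11_0 h11] :=
  continuous_square_corner cR (inT _ s0 sT) (inT _ u0 uT) d40.
have [e12 e12_0 h12] :=
  continuous_square_corner cR (inT _ s0 sT) (inT _ v0 vT) d40.
have [e21 e21_0 h21] :=
  continuous_square_corner cR (inT _ t0 tT) (inT _ u0 uT) d40.
have [e22 e22_0 h22] :=
  continuous_square_corner cR (inT _ t0 tT) (inT _ v0 vT) d40.
have [e [e0 [est euv] [l11 l12 l21 l22]]] :=
  small_margin st uv e11_0 e12_0 e21_0 e22_0.
have [F1 [F2 /= [nf f01 fsupp df [nF pF sF1 sF2 [iF1 iF2]]]]] :=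
  smooth_bump e0 est.
have [G1 [G2 /= [ng g01 gsupp dg [nG pG sG1 sG2 [iG1 iG2]]]]] :=
  smooth_bump e0 euv.
set f := F1 \- F2 in nf f01 fsupp df.
set g := G1 \- G2 in ng g01 gsupp dg.
pose phi z := f z.1 * g z.2.
have Dphi : (fun z => 'D_(1, 0) (fun w : K * K => 'D_(0, 1) phi w) z) =
    (fun z => derive1 f z.1 * derive1 g z.2).
  have [f1 _] := nf 1%N; have [g1 _] := ng 1%N.
  have -> : (fun w : K * K => 'D_(0, 1) phi w) =
      (fun z => f z.1 * derive1 g z.2).
    by apply/funext => z; have [] := is_derive_tensor2 f (g1 z.2).
  by apply/funext => z; have [] := is_derive_tensor1 (derive1 g) (f1 z.1).
(* The margin [e] keeps this compact set off the diagonal and the boundary, even when the rectangle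
   touches them. *)
pose Q := `[s + e, t - e]%classic `*` `[u + e, v - e]%classic.
have Qoff : Q `<=` offdiag T by exact: shrunk_rect_offdiag.
have phiQ z : phi z != 0 -> Q z.
  rewrite mulf_eq0 negb_or => /andP[/fsupp fz /gsupp gz].
  by split; rewrite /= in_itv.
have cQ : compact Q by apply: compact_setX; exact: segment_compact.
have clQ : closure [set z | phi z != 0] `<=` Q.
  have clQ : closed Q by apply: compact_closed => //; exact: norm_hausdorff.
  by rewrite [X in _ `<=` X]((closure_id _).1 clQ); exact: closureS.
pose w (a b : K -> K) (z : K * K) := derive1 a z.1 * derive1 b z.2.
have w0 (a b : K -> K) (z : K * K) :
  (forall x, 0 <= derive1 a x) -> (forall x, 0 <= derive1 b x) ->
  0 <= w a b z by move=> a0 b0; exact: mulr_ge0.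
(* Where a corner density vanishes, the bounds are trivial; elsewhere the point lies in [Q] and
   close to that corner. The first conjunct lets the domain of integration grow from [offdiag T] to
   the plane. *)
have corner (a b : K -> K) (cx cy r : K) z : 2 * e <= r ->
    (forall z, square T z -> `|z.1 - cx| <= r -> `|z.2 - cy| <= r ->
      `|R z.1 z.2 - R cx cy| <= d / 4) ->
    (derive1 a z.1 != 0 -> `|z.1 - cx| <= 2 * e /\ s + e <= z.1 <= t - e) ->
    (derive1 b z.2 != 0 -> `|z.2 - cy| <= 2 * e /\ u + e <= z.2 <= v - e) ->
    0 <= w a b z ->
    (offdiag T z \/ w a b z = 0) /\
    (R cx cy - d / 4) * w a b z <= R z.1 z.2 * w a b z <=
      (R cx cy + d / 4) * w a b z.
  move=> er hr ha hb wz.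
  have [wz0|wn0] := eqVneq (w a b z) 0.
    by split; [right|rewrite wz0 !mulr0 lexx].
  move: (wn0); rewrite mulf_eq0 negb_or => /andP[/ha[a1 a2] /hb[b1 b2]].
  have Qz : Q z by split; rewrite /= in_itv.
  split; first by left; exact: Qoff.
  have [/andP[z1 z1T] /andP[z2 z2T] _] := Qoff z Qz.
  have sz : square T z by split; rewrite /= in_itv/= !ltW.
  have := hr z sz (le_trans a1 er) (le_trans b1 er).
  rewrite ler_norml => /andP[c1 c2].
  by rewrite !ler_wpM2r// -?lerBlDl -?lerBlDr; move: c1 c2; clear; lra.
have pF1 x : 0 <= derive1 F1 x by have [] := pF x.
have pF2 x : 0 <= derive1 F2 x by have [] := pF x.
have pG1 x : 0 <= derive1 G1 x by have [] := pG x.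
have pG2 x : 0 <= derive1 G2 x by have [] := pG x.
have k11 z := corner F1 G1 s u e11 z l11 h11 (@sF1 _) (@sG1 _) (w0 _ _ z pF1 pG1).
have k12 z := corner F1 G2 s v e12 z l12 h12 (@sF1 _) (@sG2 _) (w0 _ _ z pF1 pG2).
have k21 z := corner F2 G1 t u e21 z l21 h21 (@sF2 _) (@sG1 _) (w0 _ _ z pF2 pG1).
have k22 z := corner F2 G2 t v e22 z l22 h22 (@sF2 _) (@sG2 _) (w0 _ _ z pF2 pG2).
have Dw z : derive1 f z.1 * derive1 g z.2 =
    w F1 G1 z - w F1 G2 z - w F2 G1 z + w F2 G2 z.
  by rewrite df dg /w/=; ring.
have I c11 c12 c21 c22 :
  (\int[leb2]_z (c11 * (w F1 G1 z) + c12 * (w F1 G2 z) +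
     c21 * (w F2 G1 z) + c22 * (w F2 G2 z))%:E =
   (c11 + c12 + c21 + c22)%:E)%E.
  have cont (F : K -> K) : nderivable 2 F -> continuous (derive1 F).
    by case=> _ h; exact: (@nderivable_cont _ 0).
  have [/cont cF1 /cont cF2] := nF 2%N; have [/cont cG1 /cont cG2] := nG 2%N.
  exact: (integral_tensor4 _ _ _ _ (And4 cF1 cF2 cG1 cG2)
    (And4 pF1 pF2 pG1 pG2) (And4 iF1 iF2 iG1 iG2)).
exists phi; split.
- split; first by move=> n; exact: is_Cn_tensor.
  + exact: (subclosed_compact (@closed_closure _ _) cQ).
  + by move=> z /clQ; exact: Qoff.
- move=> z; have /andP[? _] := f01 z.1; have /andP[? _] := g01 z.2.
  exact: mulr_ge0.
- move=> z; have [->|/phiQ [/=]] := eqVneq (phi z) 0.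
    by rewrite indicE ler0n.
  rewrite !in_itv/= => /andP[a1 a2] /andP[b1 b2].
  rewrite indicE mem_set; last first.
    by split; rewrite /= in_itv/=; apply/andP; split;
      move: e0 a1 a2 b1 b2; clear; lra.
  have /andP[? ?] := f01 z.1; have /andP[? ?] := g01 z.2.
  by rewrite /phi mulr_ile1.
(* The error is shared among the corners with the signs of [le_signed_sum4], and the left side
   becomes an integral over the plane. *)
- have -> : rect_incr R s t u v - d = (R s u - d / 4) + - (R s v + d / 4) +
    - (R t u + d / 4) + (R t v - d / 4) by rewrite /rect_incr; clear; lra.
  rewrite -I [leRHS]integral_mkcond; apply: le_integral_nomeas => z _.
  have [q11 p11] := k11 z; have [q12 p12] := k12 z.
  have [q21 p21] := k21 z; have [q22 p22] := k22 z.
  rewrite patchE; case: ifPn => [/set_mem zo|/negP zN].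
    rewrite lee_fin [X in R _ _ * X](congr1 (@^~ z) Dphi) Dw.
    by have /andP[] := le_signed_sum4 p11 p12 p21 p22.
  have zo : ~ offdiag T z by move=> h; apply: zN; exact/mem_set.
  case: q11 => [//|->]; case: q12 => [//|->].
  by case: q21 => [//|->]; case: q22 => [//|->]; rewrite !mulr0 !addr0.
- have -> : rect_incr R s t u v + d = (R s u + d / 4) + - (R s v - d / 4) +
    - (R t u - d / 4) + (R t v + d / 4) by rewrite /rect_incr; clear; lra.
  rewrite -I [leLHS]integral_mkcond; apply: le_integral_nomeas => z _.
  have [q11 p11] := k11 z; have [q12 p12] := k12 z.
  have [q21 p21] := k21 z; have [q22 p22] := k22 z.
  rewrite patchE; case: ifPn => [/set_mem zo|/negP zN].
    rewrite lee_fin [X in R _ _ * X](congr1 (@^~ z) Dphi) Dw.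
    by have /andP[] := le_signed_sum4 p11 p12 p21 p22.
  have zo : ~ offdiag T z by move=> h; apply: zN; exact/mem_set.
  case: q11 => [//|->]; case: q12 => [//|->].
  by case: q21 => [//|->]; case: q22 => [//|->]; rewrite !mulr0 !addr0.
Qed.

End test_rectangles.

(** * Measures off the diagonal and their comparison with increments of [R] *)

Section offdiag_measures.
Variables (K : realType) (T : K).
Implicit Types (R : K -> K -> K) (s t u v : K) (mu : plane_measure K).

Local Notation plane := (measurableTypeR K * measurableTypeR K)%type.

Lemma measurable_offdiag : measurable (offdiag T : set plane).
Proof.
have m1 : measurable_fun [set: plane] (fst : plane -> K) := measurable_fst.
have m2 : measurable_fun [set: plane] (snd : plane -> K) := measurable_snd.
have -> : (offdiag T : set plane) =
    (fst @^-1` `]0, T[%classic) `&` (snd @^-1` `]0, T[%classic) `&`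
    ~` ((fun z : plane => z.1 - z.2) @^-1` [set 0]).
  apply/seteqP; split=> [z [z1 z2 z12]|z [[/= z1 z2] z12]].
    split; first by split; rewrite /= in_itv.
    by move=> /= /eqP; rewrite subr_eq0; exact/negP.
  move: z1 z2; rewrite !in_itv/= => z1 z2; split=> //.
  by apply/eqP => z0; apply: z12; rewrite /= z0 subrr.
apply: measurableI; first apply: measurableI.
- by rewrite -[X in measurable X]setTI; apply: m1.
- by rewrite -[X in measurable X]setTI; apply: m2.
- apply: measurableC; rewrite -[X in measurable X]setTI.
  by apply: (measurable_funB m1 m2).
Qed.

Lemma measurable_itv_rect (i j : interval K) :
  measurable ([set` i] `*` [set` j] : set plane).
Proof. by apply: measurableX; exact: measurable_itv. Qed.

Lemma ext_measU mu (A B : set plane) : measurable A -> measurable B ->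
  A `&` B = set0 ->
  ext_meas T mu (A `|` B) = (ext_meas T mu A + ext_meas T mu B)%E.
Proof.
move=> mA mB AB; rewrite /ext_meas setIUl measureU//.
- by apply: measurableI => //; exact: measurable_offdiag.
- by apply: measurableI => //; exact: measurable_offdiag.
- by rewrite setIACA AB set0I.
Qed.

Lemma le_ext_meas mu (A B : set plane) : measurable A -> measurable B ->
  A `<=` B -> (ext_meas T mu A <= ext_meas T mu B)%E.
Proof.
move=> mA mB AB; apply: le_measure; rewrite ?inE.
- by apply: measurableI => //; exact: measurable_offdiag.
- by apply: measurableI => //; exact: measurable_offdiag.
- exact: setSI.
Qed.

Lemma ext_meas_fin mu (A : set plane) :
  finite_mass T mu -> measurable A -> ext_meas T mu A \is a fin_num.
Proof.
move=> fmu mA; rewrite ge0_fin_numE ?measure_ge0//.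
by apply: le_lt_trans fmu; exact: le_ext_meas.
Qed.

(* Its increments are the masses of half-open rectangles, hence additive even
   when lines are charged. *)
Definition quadrant_mass mu (x y : K) : K :=
  fine (ext_meas T mu (`]-oo, x]%classic `*` `]-oo, y]%classic)).

(** Each quadrant side is cut as []-oo, t] = ]-oo, s] + ]s, t]]; finiteness of the mass makes [fine]
    additive. *)
Lemma rect_incr_quadrant_mass mu s t u v : finite_mass T mu -> s <= t -> u <= v ->
  rect_incr (quadrant_mass mu) s t u v =
  fine (ext_meas T mu (`]s, t]%classic `*` `]u, v]%classic)).
Proof.
move=> fmu st uv.
pose m (i j : interval K) := fine (ext_meas T mu ([set` i] `*` [set` j])).
have fin (i j : interval K) : ext_meas T mu ([set` i] `*` [set` j]) \is a fin_num.
  exact: (ext_meas_fin fmu (measurable_itv_rect _ _)).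
have itvU (x y : K) : x <= y ->
    `]-oo, y]%classic = `]-oo, x]%classic `|` `]x, y]%classic.
  move=> xy; apply/seteqP; split=> z /=; rewrite !in_itv/=.
    by move=> zy; have [zx|xz] := leP z x; [left|right].
  by move=> [zx|/andP[]//]; exact: le_trans xy.
have itvI (x y z : K) : `]-oo, x]%classic z -> `]x, y]%classic z -> False.
  rewrite /= !in_itv/= => zx /andP[xz _].
  by move: (lt_le_trans xz zx); rewrite ltxx.
have row (x y : K) (j : interval K) : x <= y ->
    m `]-oo, y] j = m `]-oo, x] j + m `]x, y] j.
  move=> xy; rewrite /m -fineD//; congr fine.
  rewrite -ext_measU; do ?exact: measurable_itv_rect.
    by rewrite (itvU _ _ xy); congr ext_meas; apply/seteqP; split => z /=; tauto.
  by rewrite -subset0 => z [[/itvI h _] [/h]].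
have col (x y : K) (i : interval K) : x <= y ->
    m i `]-oo, y] = m i `]-oo, x] + m i `]x, y].
  move=> xy; rewrite /m -fineD//; congr fine.
  rewrite -ext_measU; do ?exact: measurable_itv_rect.
    by rewrite (itvU _ _ xy); congr ext_meas; apply/seteqP; split => z /=; tauto.
  by rewrite -subset0 => z [[_ /itvI h] [_ /h]].
rewrite /rect_incr /quadrant_mass -/(m _ _) -/(m `]s, t] `]u, v]).
rewrite -/(m `]-oo, s] `]-oo, v]) -/(m `]-oo, t] `]-oo, u]).
rewrite -/(m `]-oo, t] `]-oo, v]).
rewrite (row _ _ `]-oo, u] st) (row _ _ `]-oo, v] st) (col _ _ `]s, t] uv); ring.
Qed.

Lemma rect_incr_quadrant_mass_ge0 mu s t u v :
  finite_mass T mu -> s <= t -> u <= v ->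
  0 <= rect_incr (quadrant_mass mu) s t u v.
Proof.
move=> fmu st uv; rewrite rect_incr_quadrant_mass//.
by rewrite fine_ge0// measure_ge0.
Qed.

Lemma rect_incr_quadrant_mass_le mu s t u v :
  finite_mass T mu -> s <= t -> u <= v ->
  rect_incr (quadrant_mass mu) s t u v <= fine (ext_meas T mu (rect s t u v)).
Proof.
move=> fmu st uv; rewrite rect_incr_quadrant_mass// fine_le//.
- by apply: ext_meas_fin => //; exact: measurable_itv_rect.
- by apply: ext_meas_fin => //; exact: measurable_itv_rect.
apply: le_ext_meas; do ?exact: measurable_itv_rect.
by apply: setSX; exact: subset_itv_oc_cc.
Qed.

Lemma integral_test_le mu (phi : K * K -> K) (i j : interval K) :
  (forall z, phi z <= \1_([set` i] `*` [set` j]) z) ->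
  (\int[mu]_(z in offdiag T) (phi z)%:E <=
   ext_meas T mu ([set` i] `*` [set` j]))%E.
Proof.
move=> phile; have mij := measurable_itv_rect i j.
rewrite /ext_meas -integral_indic//; last exact: measurable_offdiag.
by apply: le_integral_nomeas => z _; rewrite lee_fin.
Qed.

(** Up to [d], the increment is at most the integral of a bump against [mup - mum], hence at most
    the [mup]-mass of the half-open rectangle; then [d] tends to 0. Degenerate rectangles carry no
    bump and are treated first. *)
Lemma offdiag_incr_le R mup mum s t u v :
  standing_assumptions T R mup mum -> finite_mass T mup ->
  0 <= s -> s <= t -> t <= T -> 0 <= u -> u <= v -> v <= T -> t <= u \/ v <= s ->
  rect_incr R s t u v <= rect_incr (quadrant_mass mup) s t u v.
Proof.
move=> [_ cR _ dR] fmu s0 st tT u0 uv vT off.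
have [->|sNt] := eqVneq s t; first by rewrite /rect_incr; lra.
have [->|uNv] := eqVneq u v; first by rewrite /rect_incr; lra.
have {sNt}slt : s < t by rewrite lt_neqAle sNt.
have {uNv}ult : u < v by rewrite lt_neqAle uNv.
rewrite rect_incr_quadrant_mass//.
apply/ler_addgt0Pr => d d0.
have [phi [tphi phi0 phi1 low _]] := test_rectangle cR s0 slt tT u0 ult vT off d0.
rewrite -lerBlDr -lee_fin fineK; last first.
  exact: (ext_meas_fin fmu (measurable_itv_rect _ _)).
apply: (le_trans low); rewrite dR//.
apply: le_trans (integral_test_le mup phi1).
(* The integral against [mum] is nonnegative and is dropped. *)
rewrite -[leRHS]sube0; apply: leeB => //.
by apply: integral_ge0 => z _; rewrite lee_fin.
Qed.

Lemma offdiag_incr_ge R mup mum s t u v :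
  standing_assumptions T R mup mum -> finite_mass T mum ->
  0 <= s -> s <= t -> t <= T -> 0 <= u -> u <= v -> v <= T -> t <= u \/ v <= s ->
  - rect_incr (quadrant_mass mum) s t u v <= rect_incr R s t u v.
Proof.
move=> [_ cR _ dR] fmu s0 st tT u0 uv vT off.
have [->|sNt] := eqVneq s t; first by rewrite /rect_incr; lra.
have [->|uNv] := eqVneq u v; first by rewrite /rect_incr; lra.
have {sNt}slt : s < t by rewrite lt_neqAle sNt.
have {uNv}ult : u < v by rewrite lt_neqAle uNv.
rewrite rect_incr_quadrant_mass//.
apply/ler_addgt0Pr => d d0.
have [phi [tphi phi0 phi1 _ up]] := test_rectangle cR s0 slt tT u0 ult vT off d0.
rewrite -lee_fin EFinN fineK; last first.
  exact: (ext_meas_fin fmu (measurable_itv_rect _ _)).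
apply: le_trans up; rewrite dR//.
have := integral_test_le mum phi1; rewrite -leeN2 => /le_trans; apply.
by rewrite leeDr//; apply: integral_ge0 => z _; rewrite lee_fin.
Qed.

End offdiag_measures.

(** * Cutting rectangles along the diagonal *)

Section tiling.
Variable K : realType.
Implicit Types (T h s t u v a b : K).

Definition subrect T s t u v :=
  [/\ 0 <= s, s <= t, t <= T & [/\ 0 <= u, u <= v & v <= T]].

Lemma subrectS T s t u v a b p q : subrect T s t u v ->
  s <= a -> a <= b -> b <= t -> u <= p -> p <= q -> q <= v ->
  subrect T a b p q.
Proof.
move=> [s0 st tT [u0 uv vT]] sa ab bt up pq qv.
by do 2?split; lra.
Qed.

(* [P c s t u v] is to be read as a bound with constant [c] on the rectangle
   [s, t] x [u, v]. *)
Definition tile_closed T h c0 (P : K -> K -> K -> K -> K -> Prop) : Prop :=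
  [/\ forall c c' s t u v, 0 <= c -> c <= c' -> subrect T s t u v ->
        P c s t u v -> P c' s t u v,
      forall c c' s m t u v, 0 <= c -> 0 <= c' ->
        subrect T s t u v -> s <= m <= t ->
        P c s m u v -> P c' m t u v -> P (2 * (c + c')) s t u v,
      forall c c' s t u m v, 0 <= c -> 0 <= c' ->
        subrect T s t u v -> u <= m <= v ->
        P c s t u m -> P c' s t m v -> P (2 * (c + c')) s t u v,
      forall s t u v, subrect T s t u v -> t <= u \/ v <= s -> P 1 s t u v &
      forall a b, subrect T a b a b -> b - a <= h -> P c0 a b a b].

(** The constant is fixed before [P], so it depends on [T], [h] and [c0] alone. Squares on the
    diagonal are peeled in steps of length [h]; a general rectangle is the square over the overlap
    of its sides plus pieces off the diagonal. *)
Lemma tiling T h c0 : 0 < h -> 0 <= c0 ->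
  exists2 c, 0 <= c & forall P : K -> K -> K -> K -> K -> Prop,
    tile_closed T h c0 P ->
    forall s t u v, subrect T s t u v -> P c s t u v.
Proof.
move=> h0 c00.
have diag n : exists2 c, c0 <= c & forall P : K -> K -> K -> K -> K -> Prop,
    tile_closed T h c0 P ->
    forall a b, subrect T a b a b -> b - a <= n.+1%:R * h -> P c a b a b.
  elim: n => [|n [c cc0 IH]].
    by exists c0 => // P [_ _ _ _ Pd] a b sab; rewrite mul1r; exact: Pd.
  (* Cutting [[a, b]^2] at [a + h] in both directions leaves the squares [[a, a + h]^2] and
     [[a + h, b]^2] and two rectangles off the diagonal; each cut doubles the sum of the
     constants. *)
  exists (2 * (2 * (c0 + 1) + 2 * (1 + c))) => [|P PT a b sab ban].
    by lra.
  have [Pm Pr Pc Po Pd] := PT; have [bah|hba] := leP (b - a) h.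
    by apply: (@Pm c0) => //; [lra|exact: Pd].
  have am : a <= a + h by lra.
  have mb : a + h <= b by lra.
  have bmn : b - (a + h) <= n.+1%:R * h.
    by move: ban; rewrite -[n.+2]addn1 natrD mulrDl mul1r; lra.
  have c_ge0 : 0 <= c := le_trans c00 cc0.
  have sub := subrectS sab; have [_ ab _ _] := sab.
  apply: (@Pr _ _ a (a + h)) => //; rewrite ?mulr_ge0 ?addr_ge0// ?am//.
  - apply: (@Pc _ _ _ _ _ (a + h)) => //; rewrite ?am//; first exact: sub.
      by apply: Pd; [exact: sub|lra].
    by apply: Po; [exact: sub|left].
  - apply: (@Pc _ _ _ _ _ (a + h)) => //; rewrite ?am//; first exact: sub.
      by apply: Po; [exact: sub|right].
    by apply: (IH P) => //; exact: sub.
have [N TN] : exists n, T <= n.+1%:R * h.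
  exists (Num.truncn (T / h)); rewrite -ler_pdivrMr// ltW//.
  exact: truncnS_gt.
have [c cc0 diagN] := diag N.
have c_ge0 : 0 <= c := le_trans c00 cc0.
(* Two outer strips of constant 4 and a middle strip of constant [2 * (2 * (1 + c) + 1)], joined by
   two cuts. *)
exists (48 + 16 * c) => [|P PT s t u v sub]; first lra.
have [Pm Pr Pc Po Pd] := PT; have [s0 st tT [u0 uv vT]] := sub.
have c1 : 1 <= 48 + 16 * c by lra.
have [tu|ut] := leP t u.
  by apply: (@Pm 1) => //; apply: Po => //; left.
have [vs|sv] := leP v s.
  by apply: (@Pm 1) => //; apply: Po => //; right.
(* [[a, b]] is the overlap of [[s, t]] and [[u, v]]. *)
pose a := Order.max s u; pose b := Order.min t v.
have sa : s <= a by rewrite le_max lexx.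
have ua : u <= a by rewrite le_max lexx orbT.
have bt : b <= t by rewrite ge_min lexx.
have bv : b <= v by rewrite ge_min lexx orbT.
have ab : a <= b by rewrite ge_max !le_min st uv !ltW.
(* One of the intervals starts at [a], so [[s, a] x [u, a]] is degenerate and counts as off the
   diagonal; likewise [[b, t] x [b, v]]. *)
have asu : a <= s \/ a <= u.
  by rewrite /a; case: (leP s u) => _; [right|left].
have btv : t <= b \/ v <= b.
  by rewrite /b; case: (leP t v) => _; [left|right].
clearbody a b.
have le_at : a <= t := le_trans ab bt; have le_av : a <= v := le_trans ab bv.
have le_sb : s <= b := le_trans sa ab; have le_ub : u <= b := le_trans ua ab.
have subS := subrectS sub.
have left_strip : P 4 s a u v.
  have -> : 4 = 2 * (1 + 1) :> K by ring.
  apply: (@Pc _ _ _ _ _ a) => //; rewrite ?ua//; first exact: subS.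
    by apply: Po; [exact: subS|case: asu; [right|left]].
  by apply: Po; [exact: subS|left].
have right_strip : P 4 b t u v.
  have -> : 4 = 2 * (1 + 1) :> K by ring.
  apply: (@Pc _ _ _ _ _ b) => //; rewrite ?le_ub//; first exact: subS.
    by apply: Po; [exact: subS|right].
  by apply: Po; [exact: subS|case: btv; [left|right]].
have middle : P (2 * (2 * (1 + c) + 1)) a b u v.
  have mid_left : P (2 * (1 + c)) a b u b.
    apply: (@Pc _ _ _ _ _ a) => //; rewrite ?ua//; first exact: subS.
      by apply: Po; [exact: subS|right].
    apply: (diagN P) => //; first exact: subS.
    by apply: le_trans TN; lra.
  apply: (@Pc _ _ _ _ _ b) => //; rewrite ?mulr_ge0 ?addr_ge0// ?le_ub//.
    exact: subS.
  by apply: Po; [exact: subS|left].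
have -> : 48 + 16 * c = 2 * (4 + 2 * (2 * (2 * (1 + c) + 1) + 4)) by ring.
apply: (@Pr _ _ s a) => //; rewrite ?mulr_ge0 ?addr_ge0// ?sa//.
  by rewrite ?mulr_ge0 ?addr_ge0 ?mulr_ge0 ?addr_ge0.
apply: (@Pr _ _ a b) => //; rewrite ?ab ?mulr_ge0 ?addr_ge0 ?mulr_ge0 ?addr_ge0//.
exact: subS.
Qed.

End tiling.

(** * Variation bounds *)

Section power_sums.
Variable K : realType.
Implicit Types (a b c rho B C : K).

Lemma powRD_ge a b rho : 1 <= rho -> 0 <= a -> 0 <= b ->
  a `^ rho + b `^ rho <= (a + b) `^ rho.
Proof.
move=> rho1 a0 b0; have rho0 : 0 < rho by exact: lt_le_trans rho1.
have rho1' : 0 <= rho - 1 by rewrite subr_ge0.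
rewrite -!(@mulr_powRB1 _ _ rho)// ?addr_ge0// mulrDl lerD//.
  by rewrite ler_wpM2l//; apply: ge0_ler_powR => //;
    rewrite ?nnegrE ?addr_ge0 ?lerDl//.
by rewrite ler_wpM2l//; apply: ge0_ler_powR => //;
    rewrite ?nnegrE ?addr_ge0 ?lerDr//.
Qed.

Lemma powRD_le a b rho : 0 <= rho -> 0 <= a -> 0 <= b ->
  (a + b) `^ rho <= 2 `^ rho * (a `^ rho + b `^ rho).
Proof.
move=> rho0; wlog ab : a b / a <= b => [H a0 b0|a0 b0].
  have [ab|/ltW ba] := leP a b; first exact: H.
  by rewrite addrC [X in _ <= _ * X]addrC; exact: H.
apply: (@le_trans _ _ ((2 * b) `^ rho)).
  by apply: ge0_ler_powR => //; rewrite ?nnegrE ?addr_ge0 ?mulr_ge0//; lra.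
by rewrite powRM// ler_wpM2l ?powR_ge0// lerDr powR_ge0.
Qed.

Lemma sum_powR_le (f : nat -> K) n rho : 1 <= rho -> (forall i, 0 <= f i) ->
  \sum_(0 <= i < n) f i `^ rho <= (\sum_(0 <= i < n) f i) `^ rho.
Proof.
move=> rho1 f0; elim: n => [|n IH]; first by rewrite !big_nil powR_ge0.
rewrite !big_nat_recr//=; apply: le_trans (powRD_ge _ _ _) => //.
  by rewrite lerD2r.
exact: sumr_ge0.
Qed.

(** A crude substitute for Minkowski's inequality; its factor 2 is the one lost at each cut of a
    rectangle. *)
Lemma sum_powRD_le (f g : nat -> K) n rho B C : 1 <= rho ->
  (forall i, 0 <= f i) -> (forall i, 0 <= g i) -> 0 <= B -> 0 <= C ->
  \sum_(0 <= i < n) f i `^ rho <= B `^ rho ->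
  \sum_(0 <= i < n) g i `^ rho <= C `^ rho ->
  \sum_(0 <= i < n) (f i + g i) `^ rho <= (2 * (B + C)) `^ rho.
Proof.
move=> rho1 f0 g0 B0 C0 fB gC; have rho0 : 0 <= rho by exact: le_trans rho1.
apply: (@le_trans _ _ (\sum_(0 <= i < n) 2 `^ rho * (f i `^ rho + g i `^ rho))).
  by apply: ler_sum => i _; exact: powRD_le.
rewrite -mulr_sumr big_split/= powRM ?addr_ge0// ler_wpM2l ?powR_ge0//.
by apply: le_trans (powRD_ge _ _ _) => //; exact: lerD.
Qed.

End power_sums.

Section variation_bounds.
Variable K : realType.
Implicit Types (R : K -> K -> K) (s t u v m rho B C : K) (x y : nat -> K).

Definition grid s t x := nondecreasing_seq x /\ forall i, s <= x i <= t.

(* Grids may repeat points, so they can be clipped by [min] and [max]. *)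
Definition row_sum R x n (p q : K) : K :=
  \sum_(0 <= i < n) `|rect_incr R (x i) (x i.+1) p q|.

(** Bounds the [rho]-th power of [V_{1,rho}] over finite initial pieces of infinite grids, which
    need not reach the endpoints of the intervals. *)
Definition variation_bounded R rho B s t u v :=
  forall x y n k, grid s t x -> grid u v y ->
  \sum_(0 <= j < k) row_sum R x n (y j) (y j.+1) `^ rho <= B `^ rho.

Lemma row_sum_ge0 R x n p q : 0 <= row_sum R x n p q.
Proof. exact: sumr_ge0. Qed.

Lemma grid_le s t x i j : grid s t x -> (i <= j)%N -> x i <= x j.
Proof. by case=> nd _; exact: nd. Qed.

Lemma grid_itv s t x i : grid s t x -> s <= x i /\ x i <= t.
Proof. by case=> _ /(_ i) /andP[]. Qed.

Lemma grid_min s m t x : s <= m -> grid s t x ->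
  grid s m (fun i => Order.min (x i) m).
Proof.
move=> sm gx; split=> [i j ij|i].
  by rewrite le_min !ge_min (grid_le gx ij) lexx orbT.
by rewrite le_min sm (grid_itv i gx).1 ge_min lexx orbT.
Qed.

Lemma grid_max s m t x : m <= t -> grid s t x ->
  grid m t (fun i => Order.max (x i) m).
Proof.
move=> mt gx; split=> [i j ij|i].
  by rewrite ge_max !le_max (grid_le gx ij) lexx orbT.
by rewrite ge_max mt (grid_itv i gx).2 le_max lexx orbT.
Qed.

(** For any [f], [f (min a m) + f (max a m) = f a + f m], and [f m] cancels in a difference. Thus a
    cell straddling [m] is cut there. *)
Lemma rect_incr_minmaxl R m a b p q : rect_incr R a b p q =
  rect_incr R (Order.min a m) (Order.min b m) p q +
  rect_incr R (Order.max a m) (Order.max b m) p q.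
Proof.
by rewrite /rect_incr; case: (leP a m); case: (leP b m) => _ _; ring.
Qed.

Lemma rect_incr_minmaxr R m a b p q : rect_incr R a b p q =
  rect_incr R a b (Order.min p m) (Order.min q m) +
  rect_incr R a b (Order.max p m) (Order.max q m).
Proof.
by rewrite /rect_incr; case: (leP p m); case: (leP q m) => _ _; ring.
Qed.

Lemma variation_bounded_weaken R rho B C s t u v : 0 <= rho -> 0 <= B -> B <= C ->
  variation_bounded R rho B s t u v -> variation_bounded R rho C s t u v.
Proof.
move=> rho0 B0 BC RB x y n k gx gy; apply: le_trans (RB x y n k gx gy) _.
by apply: ge0_ler_powR => //; rewrite nnegrE//; exact: le_trans BC.
Qed.

Lemma sum_row_powRD_le R rho B C (f g : nat -> K) x y n k :
  1 <= rho -> 0 <= B -> 0 <= C ->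
  (forall j, 0 <= f j) -> (forall j, 0 <= g j) ->
  (forall j, row_sum R x n (y j) (y j.+1) <= f j + g j) ->
  \sum_(0 <= j < k) f j `^ rho <= B `^ rho ->
  \sum_(0 <= j < k) g j `^ rho <= C `^ rho ->
  \sum_(0 <= j < k) row_sum R x n (y j) (y j.+1) `^ rho <= (2 * (B + C)) `^ rho.
Proof.
move=> rho1 B0 C0 f0 g0 Rfg fB gC.
apply: le_trans (sum_powRD_le rho1 f0 g0 B0 C0 fB gC).
apply: ler_sum => j _; apply: ge0_ler_powR; rewrite ?nnegrE ?row_sum_ge0//.
  exact: le_trans rho1.
by rewrite addr_ge0.
Qed.

(** The grid of the first variable is clipped at [m] from both sides, and each row sum is at most
    the sum of the two clipped ones. *)
Lemma variation_bounded_splitl R rho B C s m t u v :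
  1 <= rho -> 0 <= B -> 0 <= C ->
  s <= m <= t -> variation_bounded R rho B s m u v ->
  variation_bounded R rho C m t u v ->
  variation_bounded R rho (2 * (B + C)) s t u v.
Proof.
move=> rho1 B0 C0 /andP[sm mt] RB RC x y n k gx gy.
have h1 := RB _ y n k (grid_min sm gx) gy.
have h2 := RC _ y n k (grid_max mt gx) gy.
apply: (sum_row_powRD_le rho1 B0 C0 _ _ _ h1 h2) => j; try exact: row_sum_ge0.
rewrite -big_split/=; apply: ler_sum => i _.
by rewrite (rect_incr_minmaxl R m) ler_normD.
Qed.

Lemma variation_bounded_splitr R rho B C s t u m v :
  1 <= rho -> 0 <= B -> 0 <= C ->
  u <= m <= v -> variation_bounded R rho B s t u m ->
  variation_bounded R rho C s t m v ->
  variation_bounded R rho (2 * (B + C)) s t u v.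
Proof.
move=> rho1 B0 C0 /andP[um mv] RB RC x y n k gx gy.
have h1 := RB x _ n k gx (grid_min um gy).
have h2 := RC x _ n k gx (grid_max mv gy).
apply: (sum_row_powRD_le rho1 B0 C0 _ _ _ h1 h2) => j; try exact: row_sum_ge0.
rewrite -big_split/=; apply: ler_sum => i _.
by rewrite (rect_incr_minmaxr R m) ler_normD.
Qed.

(** The default value [t] continues the dissection as a constant sequence, which keeps it monotone
    and inside [[s, t]]. *)
Lemma itv_partition_grid s t p : itv_partition s t p ->
  grid s t (fun i => nth t (s :: p) i).
Proof.
move=> [path_p /eqP last_p].
have srt : sorted <=%O (s :: p) by apply: sub_path path_p => a b /ltW.
have lastE i : (size p <= i)%N -> nth t (s :: p) i = t.
  rewrite leq_eqVlt => /predU1P[<-|pi]; last by rewrite nth_default.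
  by rewrite -last_p -[size p]/(size (s :: p)).-1 nth_last/=.
have nd : nondecreasing_seq (fun i => nth t (s :: p) i).
  move=> i j ij; have [jp|pj] := ltnP j (size p).+1.
    apply: sorted_leq_nth => //.
    - exact: le_trans.
    - by rewrite inE (leq_ltn_trans ij).
  rewrite (lastE j (ltnW pj)); have [ip|pi] := ltnP i (size p).
    rewrite -[leRHS](lastE (size p))//.
    apply: sorted_leq_nth => //; [exact: le_trans|..|exact: ltnW].
    - by rewrite inE/= ltnS ltnW.
    - by rewrite inE.
  by rewrite lastE.
split=> // i; apply/andP; split; first exact: (nd 0%N i).
rewrite -[leRHS](lastE (maxn i (size p))) ?leq_maxr//.
by apply: nd; exact: leq_maxl.
Qed.

Lemma mixed_variation_le R rho B s t u v : 1 <= rho -> 0 <= B ->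
  variation_bounded R rho B s t u v ->
  (mixed_variation 1 rho R s t u v <= B%:E)%E.
Proof.
move=> rho1 B0 RB; have rho0 : 0 < rho by exact: lt_le_trans rho1.
apply: ge_ereal_sup => _ [p [q [sp sq ->]]]; rewrite lee_fin.
have gp := itv_partition_grid sp; have gq := itv_partition_grid sq.
have BE : (B `^ rho) `^ rho^-1 = B by rewrite -powRrM mulfV ?gt_eqF// powRr1.
rewrite -BE; apply: le_trans (_ : (_ `^ rho^-1 <= _)); last first.
  apply: ge0_ler_powR (RB _ _ (size p) (size q) gp gq).
  - by rewrite invr_ge0 ltW.
  - by rewrite nnegrE sumr_ge0// => j _; exact: powR_ge0.
  - by rewrite nnegrE powR_ge0.
rewrite le_eqVlt; apply/orP; left; apply/eqP.
congr (_ `^ _); apply: eq_big_nat => j /andP[_ jq].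
rewrite divr1; congr (_ `^ _); apply: eq_big_nat => i /andP[_ ip].
(* All indices are in range, so the different default values of [variation_sum] and of the grids do
   not matter. *)
rewrite powRr1//; congr `|rect_incr R _ _ _ _|; apply: set_nth_default;
  by rewrite /= ?ltnS// ltnW.
Qed.

End variation_bounds.

Section dominated_variation.
Variable K : realType.
Implicit Types (R F : K -> K -> K) (s t u v : K).

(** The increments of [F] telescope along the grid; the end pieces not covered by it are
    nonnegative. *)
Lemma row_sum_dominated R F s t p q x n : grid s t x ->
  (forall a b, s <= a -> a <= b -> b <= t ->
     `|rect_incr R a b p q| <= rect_incr F a b p q) ->
  row_sum R x n p q <= rect_incr F s t p q.
Proof.
move=> gx RF.
have F0 a b : s <= a -> a <= b -> b <= t -> 0 <= rect_incr F a b p q.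
  by move=> sa ab bt; exact: le_trans (RF a b sa ab bt).
have xs i := (grid_itv i gx).1; have xt i := (grid_itv i gx).2.
apply: (@le_trans _ _ (rect_incr F (x 0%N) (x n) p q)).
  rewrite /row_sum; elim: n => [|n IH].
    by rewrite big_nil F0.
  rewrite big_nat_recr//=.
  have := RF _ _ (xs n) (grid_le gx (leqnSn n)) (xt n.+1).
  by move: IH; rewrite /rect_incr; lra.
have := F0 _ _ (lexx s) (xs 0%N) (xt 0%N).
have := F0 _ _ (xs n) (xt n) (lexx t).
by rewrite /rect_incr; lra.
Qed.

(** As [rho >= 1], the sum of powers is at most the power of the full double sum, which telescopes
    in both variables. *)
Lemma variation_bounded_dominated R F (rho : K) s t u v : 1 <= rho ->
  (forall a b p q, s <= a -> a <= b -> b <= t -> u <= p -> p <= q -> q <= v ->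
     `|rect_incr R a b p q| <= rect_incr F a b p q) ->
  variation_bounded R rho (rect_incr F s t u v) s t u v.
Proof.
move=> rho1 RF x y n k gx gy.
have [sx0 x0t] := grid_itv 0%N gx.
have st : s <= t by exact: le_trans x0t.
have F0 p q : u <= p -> p <= q -> q <= v -> 0 <= rect_incr F s t p q.
  by move=> up pq qv; exact: le_trans (RF s t p q _ _ _ _ _ _).
have ys i := (grid_itv i gy).1; have yt i := (grid_itv i gy).2.
apply: le_trans (sum_powR_le _ rho1 _) _; first by move=> j; exact: row_sum_ge0.
have le_sum k' : \sum_(0 <= j < k') row_sum R x n (y j) (y j.+1) <=
    rect_incr F s t (y 0%N) (y k').
  elim: k' => [|k' IH]; first by rewrite big_nil F0.
  rewrite big_nat_recr//=.
  have yk := grid_le gy (leqnSn k').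
  have := row_sum_dominated n gx (fun a b sa ab bt =>
    RF a b _ _ sa ab bt (ys k') yk (yt k'.+1)).
  by move: IH; rewrite /rect_incr; lra.
have bnd : \sum_(0 <= j < k) row_sum R x n (y j) (y j.+1) <= rect_incr F s t u v.
  apply: le_trans (le_sum k) _.
  have := F0 _ _ (lexx u) (ys 0%N) (yt 0%N).
  have := F0 _ _ (ys k) (yt k) (lexx v).
  by rewrite /rect_incr; lra.
have sum0 : 0 <= \sum_(0 <= j < k) row_sum R x n (y j) (y j.+1).
  by apply: sumr_ge0 => j _; exact: row_sum_ge0.
apply: ge0_ler_powR => //; first exact: le_trans rho1.
by rewrite nnegrE (le_trans sum0).
Qed.

End dominated_variation.

(** * Part A: the negative part has finite mass *)

Section continuous_negative_part.
Variables (K : realType) (T : K) (R : K -> K -> K) (mup mum : plane_measure K).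
Hypothesis RT : standing_assumptions T R mup mum.

Lemma rect_incr_diag s t : s \in `[0, T] -> t \in `[0, T] ->
  rect_incr R s t s t = sigma2 R s t.
Proof.
by case: RT => sym _ _ _ sT tT; rewrite /rect_incr /sigma2 (sym t s)//; ring.
Qed.

Lemma rect_sub_square s t u v :
  s <= t -> u <= v -> rect s t u v `<=` square T -> subrect T s t u v.
Proof.
move=> st uv sub.
have [] := sub (s, u); first by split; rewrite /= in_itv/= lexx.
rewrite /= !in_itv/= => /andP[s0 _] /andP[u0 _].
have [] := sub (t, v); first by split; rewrite /= in_itv/= lexx ?st ?uv.
by rewrite /= !in_itv/= => /andP[_ tT] /andP[_ vT].
Qed.

Lemma rect_incr_ge_mass h : finite_mass T mum -> 0 < h ->
  (forall s t : K, s \in `[0, T] -> t \in `[0, T] -> `|t - s| <= h ->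
     0 <= sigma2 R s t) ->
  forall s t u v, subrect T s t u v ->
  - rect_incr (quadrant_mass T mum) s t u v <= rect_incr R s t u v.
Proof.
move=> fmu h0 sig; pose G := quadrant_mass T mum.
have [c _ tile] := tiling T h0 (lexx 0).
(* The predicate ignores the constant: the inequality is additive under cuts, so it is enough to
   have it off the diagonal and on small diagonal squares. *)
apply: (tile (fun _ s t u v => - rect_incr G s t u v <= rect_incr R s t u v)).
split.
- by [].
- by move=> _ _ s m t u v _ _ _ _; rewrite /rect_incr; lra.
- by move=> _ _ s t u m v _ _ _ _; rewrite /rect_incr; lra.
- by move=> s t u v [s0 st tT [u0 uv vT]]; exact: (offdiag_incr_ge RT).
- move=> a b [a0 ab bT _] bah.
  have aT : a \in `[0, T] by rewrite in_itv/= a0 (le_trans ab).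
  have bT' : b \in `[0, T] by rewrite in_itv/= bT (le_trans a0).
  rewrite rect_incr_diag//; apply: (@le_trans _ _ 0).
    by rewrite oppr_le0 rect_incr_quadrant_mass_ge0.
  by apply: sig => //; rewrite ger0_norm ?subr_ge0.
Qed.

Lemma V1_le h : finite_mass T mum -> 0 < h ->
  (forall s t : K, s \in `[0, T] -> t \in `[0, T] -> `|t - s| <= h ->
     0 <= sigma2 R s t) ->
  forall s t u v, subrect T s t u v ->
  (mixed_variation 1 1 R s t u v <=
     (rect_incr R s t u v)%:E + 2%:E * ext_meas T mum (rect s t u v))%E.
Proof.
move=> fmu h0 sig s t u v sub; have [s0 st tT [u0 uv vT]] := sub.
pose G := quadrant_mass T mum; pose F x y := R x y + 2 * G x y.
have FE a b p q :
    rect_incr F a b p q = rect_incr R a b p q + 2 * rect_incr G a b p q.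
  by rewrite /rect_incr /F; ring.
have RF : variation_bounded R 1 (rect_incr F s t u v) s t u v.
  apply: variation_bounded_dominated => // a b p q sa ab bt up pq qv.
  have := rect_incr_quadrant_mass_ge0 fmu ab pq.
  have subab : subrect T a b p q by repeat split; lra.
  have := rect_incr_ge_mass fmu h0 sig subab; rewrite FE -/G.
  by rewrite ler_norml => ? ?; apply/andP; split; lra.
have fin : ext_meas T mum (rect s t u v) \is a fin_num.
  by apply: ext_meas_fin => //; exact: measurable_itv_rect.
have F0 : 0 <= rect_incr F s t u v.
  have := rect_incr_quadrant_mass_ge0 fmu st uv.
  by have := rect_incr_ge_mass fmu h0 sig sub; rewrite FE -/G; lra.
apply: le_trans (mixed_variation_le (lexx 1) F0 RF) _.
rewrite -(fineK fin) -EFinM -EFinD lee_fin FE lerD2l ler_wpM2l//.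
exact: rect_incr_quadrant_mass_le.
Qed.

End continuous_negative_part.

(** * Part B: the positive part has finite mass *)

Section continuous_positive_part.
Variables (K : realType) (T h rho : K) (R : K -> K -> K).
Variables (mup mum : plane_measure K) (omega : K -> K -> K).
Hypotheses (rho1 : 1 <= rho) (h0 : 0 < h).
Hypothesis RT : standing_assumptions T R mup mum.
Hypothesis HB : partB_hypotheses T h rho R mup omega.

Let G := quadrant_mass T mup.
Let rho0 : 0 < rho. Proof. exact: lt_le_trans rho1. Qed.
Let fmu : finite_mass T mup. Proof. by case: HB => _ []. Qed.

Let mem0T (x : K) : 0 <= x -> x <= T -> x \in `[0, T].
Proof. by move=> x0 xT; rewrite in_itv/= x0. Qed.

Let om0 s t : 0 <= s -> s <= t -> t <= T -> 0 <= omega s t.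
Proof. by case: HB => -[nn _] _ _ _; exact: nn. Qed.

Lemma omega_le s a b t : 0 <= s -> s <= a -> a <= b -> b <= t -> t <= T ->
  omega a b <= omega s t.
Proof.
move=> s0 sa ab bt tT; have [[_ sup] _ _ _] := HB.
have a0 : 0 <= a by lra. have bT : b <= T by lra. have at' : a <= t by lra.
have := sup s a t s0 sa at' tT; have := sup a b t a0 ab bt tT.
have := om0 s0 sa (le_trans at' tT); have := om0 (le_trans a0 ab) bt tT.
lra.
Qed.

Lemma sum_omega_le s t (y : nat -> K) k : 0 <= s -> t <= T -> grid s t y ->
  \sum_(0 <= j < k) omega (y j) (y j.+1) <= omega s t.
Proof.
move=> s0 tT gy; have [[_ sup] _ _ _] := HB.
have ys i := (grid_itv i gy).1; have yt i := (grid_itv i gy).2.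
have y0 i : 0 <= y i by exact: le_trans (ys i).
have yT i : y i <= T by exact: le_trans tT.
apply: (@le_trans _ _ (omega (y 0%N) (y k))).
  elim: k => [|k IH]; first by rewrite big_nil om0.
  rewrite big_nat_recr//=.
  have := sup _ _ _ (y0 0%N) (grid_le gy (leq0n k)) (grid_le gy (leqnSn k))
    (yT _).
  by move: IH; lra.
by apply: omega_le => //; exact: grid_le gy _.
Qed.

Lemma sigma2_le_omega s t : 0 <= s -> s <= t -> t <= T ->
  `|sigma2 R s t| <= omega s t `^ rho^-1.
Proof.
move=> s0; rewrite le_eqVlt => /predU1P[<-|st] tT; last first.
  by case: HB => _ _ _; exact.
by rewrite /sigma2 (_ : _ + _ - _ = 0) ?normr0 ?powR_ge0//; ring.
Qed.

(** From [R <= G] and [0 <= G] on increments, both [R] and [- R] are at most [2 * G - R]. *)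
Lemma offdiag_incr_norm_le s t u v : subrect T s t u v -> t <= u \/ v <= s ->
  `|rect_incr R s t u v| <= rect_incr (fun x y => 2 * G x y - R x y) s t u v.
Proof.
move=> [s0 st tT [u0 uv vT]] off.
have := offdiag_incr_le RT fmu s0 st tT u0 uv vT off.
have := rect_incr_quadrant_mass_ge0 fmu st uv.
have -> : rect_incr (fun x y => 2 * G x y - R x y) s t u v =
    2 * rect_incr G s t u v - rect_incr R s t u v by rewrite /rect_incr; ring.
by rewrite ler_norml -/G => ? ?; apply/andP; split; lra.
Qed.

(* The parts of the row off the diagonal contribute [2 G - R], and the part
   over [p, q] contributes [sigma2 p q]; adding up, the increments of [R] over
   the whole row [s, t] enter with a minus sign and are nonnegative. *)
Lemma row_sum_le s t p q x n : 0 <= s -> t <= T -> t - s <= h ->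
  s <= p -> p <= q -> q <= t -> grid s t x ->
  row_sum R x n p q <= 2 * sigma2 R p q + 2 * rect_incr G s t p q.
Proof.
move=> s0 tT sth sp pq qt gx; have [_ _ nested _] := HB.
have [sym _ _ _] := RT.
have p0 : 0 <= p by lra. have qT : q <= T by lra.
have p_in : p \in `[0, T] by apply: mem0T; lra.
have q_in : q \in `[0, T] by apply: mem0T; lra.
pose F x y := 2 * G x y - R x y.
(* The grid is clipped to [[s, p]], [[p, q]] and [[q, t]]; only the middle part meets the diagonal
   over the column [[p, q]] in more than a corner. *)
have g1 := grid_min sp gx.
have g2 := grid_min pq (grid_max (le_trans pq qt) gx).
have g3 := grid_max qt (grid_max (le_trans pq qt) gx).
have r1 : row_sum R (fun i => Order.min (x i) p) n p q <= rect_incr F s p p q.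
  apply: row_sum_dominated g1 _ => a b sa ab bp; apply: offdiag_incr_norm_le.
    by repeat split; lra.
  by left.
have r3 : row_sum R (fun i => Order.max (Order.max (x i) p) q) n p q <=
    rect_incr F q t p q.
  apply: row_sum_dominated g3 _ => a b qa ab bt; apply: offdiag_incr_norm_le.
    by repeat split; lra.
  by right.
have r2 : row_sum R (fun i => Order.min (Order.max (x i) p) q) n p q <=
    rect_incr R p q p q.
  apply: row_sum_dominated g2 _ => a b pa ab bq.
  have a_in : a \in `[0, T] by apply: mem0T; lra.
  have b_in : b \in `[0, T] by apply: mem0T; lra.
  have pqh : `|q - p| <= h by rewrite ger0_norm; lra.
  have := nested p q a b p0 pa ab bq qT pqh.
  (* Nestedness speaks of [[a, b]] inside [[p, q]] in the second variable; symmetry exchanges the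
     two. *)
  have -> : rect_incr R p q a b = rect_incr R a b p q.
    by rewrite /rect_incr (sym p a)// (sym p b)// (sym q a)// (sym q b)//; ring.
  by move=> ?; rewrite ger0_norm//; lra.
have r : row_sum R x n p q <= row_sum R (fun i => Order.min (x i) p) n p q +
    (row_sum R (fun i => Order.min (Order.max (x i) p) q) n p q +
     row_sum R (fun i => Order.max (Order.max (x i) p) q) n p q).
  rewrite /row_sum -!big_split/=; apply: ler_sum => i _.
  rewrite (rect_incr_minmaxl R p) (le_trans (ler_normD _ _))// lerD2l.
  by rewrite (rect_incr_minmaxl R q) ler_normD.
have Rst : 0 <= 2 * rect_incr R s t p q.
  by apply: nested => //; rewrite ger0_norm; lra.
have Gpq := rect_incr_quadrant_mass_ge0 fmu pq pq.
(* The three bounds add up to [2 * R(p,q;p,q) - R(s,t;p,q) + 2 * G(s,t;p,q) - 2 * G(p,q;p,q)]; the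
   two negative terms are dropped. *)
apply: (le_trans r); rewrite -(rect_incr_diag RT)//.
move: r1 r2 r3 Rst Gpq; rewrite -/G /F /rect_incr; lra.
Qed.

(** The row bound has two parts: the [rho]-th powers of the first are summed by super-additivity of
    [omega], those of the second by telescoping the mass. *)
Lemma near_diag_variation s t : 0 <= s -> s <= t -> t <= T -> t - s <= h ->
  variation_bounded R rho
    (4 * (omega s t `^ rho^-1 + fine (ext_meas T mup (rect s t s t)))) s t s t.
Proof.
move=> s0 st tT sth x y n k gx gy.
have ys i := (grid_itv i gy).1; have yt i := (grid_itv i gy).2.
have yS i := grid_le gy (leqnSn i).
have y0 i : 0 <= y i by exact: le_trans (ys i).
have yT i : y i <= T by exact: le_trans tT.
set g := fine _.
have Gst0 p q : p <= q -> 0 <= rect_incr G s t p q.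
  by move=> pq; exact: rect_incr_quadrant_mass_ge0.
have Gst : rect_incr G s t s t <= g by exact: rect_incr_quadrant_mass_le.
have g0 : 0 <= g by apply: le_trans Gst; exact: Gst0.
(* The outer 2 is the loss in adding the two parts, the inner ones come from [row_sum_le]. *)
have -> : 4 * (omega s t `^ rho^-1 + g) = 2 * (2 * omega s t `^ rho^-1 + 2 * g).
  by ring.
apply: (sum_row_powRD_le (f := fun j => 2 * omega (y j) (y j.+1) `^ rho^-1)
  (g := fun j => 2 * rect_incr G s t (y j) (y j.+1))) => //.
- by rewrite mulr_ge0// powR_ge0.
- by rewrite mulr_ge0.
- by move=> j; rewrite mulr_ge0// powR_ge0.
- by move=> j; rewrite mulr_ge0// Gst0.
- move=> j; apply: (le_trans (row_sum_le n s0 tT sth (ys j) (yS j) (yt _) gx)).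
  rewrite lerD2r ler_wpM2l//; apply: le_trans (ler_norm _) _.
  exact: sigma2_le_omega.
- have powE w : 0 <= w -> (2 * w `^ rho^-1) `^ rho = 2 `^ rho * w.
    by move=> w0; rewrite powRM ?powR_ge0// -powRrM mulVf ?gt_eqF// powRr1.
  rewrite powE ?om0//.
  under eq_bigr => j _ do rewrite powE ?om0//.
  by rewrite -mulr_sumr ler_wpM2l ?powR_ge0// sum_omega_le.
- apply: le_trans (sum_powR_le _ rho1 _) _.
    by move=> j; rewrite mulr_ge0// Gst0.
  apply: ge0_ler_powR; rewrite ?nnegrE ?mulr_ge0 ?(ltW rho0)//.
    by apply: sumr_ge0 => j _; rewrite mulr_ge0// Gst0.
  rewrite -mulr_sumr ler_wpM2l//; apply: le_trans Gst.
  apply: (@le_trans _ _ (rect_incr G s t (y 0%N) (y k))).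
    elim: k => [|k IH]; first by rewrite big_nil Gst0.
    by rewrite big_nat_recr//=; move: IH; rewrite /rect_incr; lra.
  have := Gst0 _ _ (ys 0%N); have := Gst0 _ _ (yt k).
  by rewrite /rect_incr; lra.
Qed.

Let E s t u v := omega s t `^ (2 * rho)^-1 * omega u v `^ (2 * rho)^-1 +
  fine (ext_meas T mup (rect s t u v)).

Let rho20 : 0 <= (2 * rho)^-1.
Proof. by rewrite invr_ge0 mulr_ge0// ltW. Qed.

Let E_ge0 s t u v : 0 <= E s t u v.
Proof. by rewrite addr_ge0 ?mulr_ge0 ?powR_ge0// fine_ge0// measure_ge0. Qed.

Let E_le s t u v a b p q : subrect T s t u v ->
  s <= a -> a <= b -> b <= t -> u <= p -> p <= q -> q <= v ->
  E a b p q <= E s t u v.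
Proof.
move=> [s0 st tT [u0 uv vT]] sa ab bt up pq qv; apply: lerD.
  apply: ler_pM; rewrite ?powR_ge0//; apply: ge0_ler_powR => //;
    rewrite ?nnegrE ?om0 ?omega_le//; lra.
rewrite fine_le//.
- by apply: ext_meas_fin => //; exact: measurable_itv_rect.
- by apply: ext_meas_fin => //; exact: measurable_itv_rect.
apply: le_ext_meas; do ?exact: measurable_itv_rect.
move=> z [/=]; rewrite !in_itv/= => /andP[z1 z2] /andP[z3 z4].
by split; rewrite /= in_itv/=; apply/andP; split; lra.
Qed.

Let powR_half (w : K) : w `^ (2 * rho)^-1 = Num.sqrt (w `^ rho^-1).
Proof. by rewrite invfM mulrC powRrM powR12_sqrt ?powR_ge0. Qed.

(** Cauchy-Schwarz bounds [- R] by square roots of [sigma2], hence by the product of powers of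
    [omega]; the mass bounds [G]. *)
Lemma offdiag_bound s t u v : cauchy_schwarz T R -> subrect T s t u v ->
  rect_incr (fun x y => 2 * G x y - R x y) s t u v <= 2 * E s t u v.
Proof.
move=> CS [s0 st tT [u0 uv vT]].
have FE : rect_incr (fun x y => 2 * G x y - R x y) s t u v =
    2 * rect_incr G s t u v - rect_incr R s t u v by rewrite /rect_incr; ring.
have Gg : rect_incr G s t u v <= fine (ext_meas T mup (rect s t u v)).
  exact: rect_incr_quadrant_mass_le.
have sqrt_le a b : 0 <= a -> a <= b -> b <= T ->
    Num.sqrt `|rect_incr R a b a b| <= omega a b `^ (2 * rho)^-1.
  move=> a0 ab bT; rewrite (rect_incr_diag RT) ?mem0T//; [|lra..].
  rewrite powR_half ler_wsqrtr//.
  exact: sigma2_le_omega.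
have Rw : - rect_incr R s t u v <=
    omega s t `^ (2 * rho)^-1 * omega u v `^ (2 * rho)^-1.
  apply: le_trans (ler_norm _) _; rewrite normrN.
  apply: (le_trans (CS s t u v s0 st tT u0 uv vT)).
  by rewrite ler_pM ?sqrtr_ge0// sqrt_le.
have w0 : 0 <= omega s t `^ (2 * rho)^-1 * omega u v `^ (2 * rho)^-1.
  by rewrite mulr_ge0// powR_ge0.
by rewrite FE /E; lra.
Qed.

Let split_le (c c' e1 e2 e : K) : 0 <= c -> 0 <= c' -> e1 <= e -> e2 <= e ->
  2 * (2 * c * e1 + 2 * c' * e2) <= 2 * (2 * (c + c')) * e.
Proof.
move=> c0 c'0 e1e e2e.
have -> : 2 * (2 * (c + c')) * e = 2 * (2 * c * e + 2 * c' * e) by ring.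
by rewrite ler_wpM2l// lerD// ler_wpM2l// mulr_ge0.
Qed.

(** The factor 2 in the bound is that of [offdiag_bound], so constant 1 fits off the diagonal; the 4
    of [near_diag_variation] then gives [c0 = 2]. *)
Lemma tile_closed_variation : cauchy_schwarz T R ->
  tile_closed T h 2 (fun c s t u v =>
    variation_bounded R rho (2 * c * E s t u v) s t u v).
Proof.
move=> CS; split.
- move=> c c' s t u v c0 cc' _; apply: variation_bounded_weaken.
  + exact: ltW.
  + by rewrite mulr_ge0// mulr_ge0.
  + by rewrite ler_wpM2r// ler_wpM2l.
- move=> c c' s m t u v c0 c'0 sub /andP[sm mt] b1 b2.
  have [s0 st tT [u0 uv vT]] := sub.
  have sm_t : s <= m <= t by rewrite sm.
  have B1 : 0 <= 2 * c * E s m u v by rewrite mulr_ge0// mulr_ge0.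
  have B2 : 0 <= 2 * c' * E m t u v by rewrite mulr_ge0// mulr_ge0.
  apply: variation_bounded_weaken
    (variation_bounded_splitl rho1 B1 B2 sm_t b1 b2).
  + exact: ltW.
  + by rewrite mulr_ge0// addr_ge0.
  + by apply: split_le => //; apply: (E_le sub).
- move=> c c' s t u m v c0 c'0 sub /andP[um mv] b1 b2.
  have [s0 st tT [u0 uv vT]] := sub.
  have um_v : u <= m <= v by rewrite um.
  have B1 : 0 <= 2 * c * E s t u m by rewrite mulr_ge0// mulr_ge0.
  have B2 : 0 <= 2 * c' * E s t m v by rewrite mulr_ge0// mulr_ge0.
  apply: variation_bounded_weaken
    (variation_bounded_splitr rho1 B1 B2 um_v b1 b2).
  + exact: ltW.
  + by rewrite mulr_ge0// addr_ge0.
  + by apply: split_le => //; apply: (E_le sub).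
- move=> s t u v sub off; have [s0 st tT [u0 uv vT]] := sub.
  apply: variation_bounded_weaken (variation_bounded_dominated rho1 _).
  + exact: ltW.
  + by apply: le_trans (offdiag_incr_norm_le sub off).
  + by rewrite mulr1; exact: offdiag_bound.
  + move=> a b p q sa ab bt up pq qv; apply: offdiag_incr_norm_le.
      by repeat split; lra.
    by case: off => ?; [left|right]; lra.
- move=> a b [a0 ab bT _] bah.
  have := near_diag_variation a0 ab bT bah.
  suff -> : 2 * 2 * E a b a b =
    4 * (omega a b `^ rho^-1 + fine (ext_meas T mup (rect a b a b))) by [].
  rewrite /E powR_half -[X in X + _]expr2.
  by rewrite sqr_sqrtr ?powR_ge0//; ring.
Qed.

End continuous_positive_part.

Theorem theorem2p2 (K : realType) :
  (* Part A *)
  (forall (T : K) (R : K -> K -> K) (mup mum : plane_measure K),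
     0 < T -> standing_assumptions T R mup mum ->
     finite_mass T mum -> continuous_distribution T mum ->
     (exists2 h : K, 0 < h &
        forall s t : K, s \in `[0, T] -> t \in `[0, T] -> `|t - s| <= h ->
          0 <= sigma2 R s t) ->
     forall s t u v : K, s <= t -> u <= v -> rect s t u v `<=` square T ->
       (mixed_variation 1 1 R s t u v <=
        (rect_incr R s t u v)%:E + 2%:E * ext_meas T mum (rect s t u v))%E)
  /\
  (* Part B, with a constant depending on rho only *)
  (forall rho : K, 1 <= rho ->
   exists C : K,
   forall (T h : K) (R : K -> K -> K) (mup mum : plane_measure K)
     (omega : K -> K -> K),
     0 < T -> 0 < h -> standing_assumptions T R mup mum ->
     partB_hypotheses T h rho R mup omega ->
     forall s t : K, s <= t -> rect s t s t `<=` near_diag T h ->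
       (mixed_variation 1 rho R s t s t <=
        C%:E * ((omega s t `^ rho^-1)%:E + ext_meas T mup (rect s t s t)))%E)
  /\
  (* Part B under Cauchy-Schwarz, with a constant depending on rho, h, T *)
  (forall rho h T : K, 1 <= rho -> 0 < h -> 0 < T ->
   exists C : K,
   forall (R : K -> K -> K) (mup mum : plane_measure K) (omega : K -> K -> K),
     standing_assumptions T R mup mum ->
     partB_hypotheses T h rho R mup omega ->
     cauchy_schwarz T R ->
     forall s t u v : K, s <= t -> u <= v -> rect s t u v `<=` square T ->
       (mixed_variation 1 rho R s t u v <=
        C%:E * ((omega s t `^ (2 * rho)^-1 * omega u v `^ (2 * rho)^-1)%:E
                + ext_meas T mup (rect s t u v)))%E).

Proof.
split; [|split].
- move=> T R mup mum T0 RT fmu _ [h h0 sig] s t u v st uv sub.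
  exact: (V1_le RT fmu h0 sig (rect_sub_square st uv sub)).
- move=> rho rho1; exists 4 => T h R mup mum omega T0 h0 RT HB s t st sub.
  have [|s0 _ tT _] := @rect_sub_square _ T s t s t st st.
    by move=> z /sub[].
  (* The corner farthest from the diagonal gives [t - s <= h]. *)
  have [_ sth] : near_diag T h (t, s).
    by apply: sub; split; rewrite /= in_itv/= lexx st.
  rewrite /= ger0_norm ?subr_ge0// in sth.
  have [_ [fmu _] _ _] := HB.
  have fin : ext_meas T mup (rect s t s t) \is a fin_num.
    by apply: ext_meas_fin => //; exact: measurable_itv_rect.
  rewrite -(fineK fin) -EFinD -EFinM.
  apply: mixed_variation_le => //.
    by rewrite mulr_ge0// addr_ge0 ?powR_ge0// fine_ge0// measure_ge0.
  exact: (near_diag_variation rho1 RT HB).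
- move=> rho h T rho1 h0 T0.
  (* The constant is obtained before [R], the measures and [omega] are introduced. *)
  have [c c0 tile] := tiling T h0 (ler0n K 2).
  exists (2 * c) => R mup mum omega RT HB CS s t u v st uv sub.
  have [_ [fmu _] _ _] := HB.
  have fin : ext_meas T mup (rect s t u v) \is a fin_num.
    by apply: ext_meas_fin => //; exact: measurable_itv_rect.
  rewrite -(fineK fin) -EFinD -EFinM.
  apply: mixed_variation_le => //.
    rewrite mulr_ge0 ?mulr_ge0// addr_ge0 ?mulr_ge0 ?powR_ge0//.
    by rewrite fine_ge0// measure_ge0.
  apply: (tile _ (tile_closed_variation rho1 RT HB CS)).
  exact: rect_sub_square.
Qed.
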